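(* Let $\mathcal S$ be a complete separable metric space, $\mu$ a boundedly finite nonatomic Borel measure on $\mathcal S$, $a>0$ and $c>0$. For $k\in\mathbb N$ let $N_k$ be a generalized Waring process on $\mathcal S$ with parameters $a$, $\rho=ck$, $k$ and parameter measure $\mu$. Then, as $k\to\infty$, $N_k$ converges weakly (in distribution, as point processes) to the negative binomial process $N$ with parameters $a$ and $c$; in particular $P\{N_k(A)=0\}\to \left(\frac{c}{c+\mu(A)}\right)^{a}=P\{N(A)=0\}$ for every bounded Borel set $A$.
   Context: For $x>0$, $\beta\ge0$ write $x_{(\beta)}=\Gamma(x+\beta)/\Gamma(x)$, with $0_{(0)}=1$ and $0_{(n)}=0$ for integers $n\ge1$. For $a,\rho>0$ and $k_1,\dots,k_s\ge 0$, $\mathrm{MGWD}(a;k_1,\dots,k_s;\rho)$ denotes the law on $\{0,1,2,\dots\}^s$ with $P(X_i=x_i,\ i=1,\dots,s)=\frac{\rho_{(\sum_i k_i)}\,a_{(\sum_i x_i)}}{(\rho+a)_{(\sum_i k_i+\sum_i x_i)}}\prod_{i=1}^s\frac{(k_i)_{(x_i)}}{x_i!}$. A point process $N$ on a complete separable metric space $\mathcal S$ is a generalized Waring process with parameters $a,\rho,k>0$ and parameter measure $\mu$ (a boundedly finite Borel measure) if for every finite family of pairwise disjoint bounded Borel sets $A_1,\dots,A_l$, $(N(A_1),\dots,N(A_l))$ has the $\mathrm{MGWD}(a;k\mu(A_1),\dots,k\mu(A_l);\rho)$ distribution. The negative binomial process with parameters $a,c>0$ (and parameter measure $\mu$) is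 the point process $N$ on $\mathcal S$ whose finite-dimensional distributions have probability generating functions $E\prod_{i=1}^n z_i^{N(A_i)}=\big(1+\tfrac1c\sum_{i=1}^n(1-z_i)\mu(A_i)\big)^{-a}$ for pairwise disjoint bounded Borel sets $A_1,\dots,A_n$ and $|z_i|\le1$ (the gamma-mixed Poisson process). *)

(* Defs.v *)
From HB Require Import structures.
From mathcomp Require Import all_boot all_order all_algebra.
From mathcomp Require Import all_classical all_reals all_analysis.
From mathcomp Require Import measurable_realfun.
Set Implicit Arguments. Unset Strict Implicit. Unset Printing Implicit Defensive.
Import Order.TTheory GRing.Theory Num.Theory.
Import numFieldNormedType.Exports.
Local Open Scope classical_set_scope.
Local Open Scope ring_scope.

Notation borelT S := (g_sigma_algebraType (@open S)).

Section Defs.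
Context {R : realType}.

Definition Gamma (x : R) : R :=
  fine (\int[lebesgue_measure]_(t in `]0%R, +oo[%classic)
          ((t `^ (x - 1)) * expR (- t))%:E)%E.

(** x_(b) = Gamma(x+b)/Gamma(x) for x > 0, with 0_(0) = 1 and 0_(n) = 0
    for n >= 1 (only used with integer b when x = 0). *)
Definition rising (x b : R) : R :=
  if x == 0 then (b == 0)%:R else Gamma (x + b) / Gamma x.

Definition mgwd_pmf (a rho : R) (l : nat) (k : 'I_l -> R) (x : 'I_l -> nat) : R :=
  let K := \sum_(i < l) k i in
  let X := (\sum_(i < l) x i)%N in
  rising rho K * rising a X%:R / rising (rho + a) (K + X%:R) *
  \prod_(i < l) (rising (k i) (x i)%:R / ((x i)`!)%:R).

Definition cnt (v : \bar R) : nat := Num.truncn (fine v).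

Context (S : completePseudoMetricType R).

Definition bounded_set (A : set S) : Prop := exists (x : S) (r : R), A `<=` ball x r.

Definition bounded_borel (A : set S) : Prop :=
  (measurable (A : set (borelT S))) /\ bounded_set A.

Definition bfinite (nu : {measure set (borelT S) -> \bar R}) : Prop :=
  forall A : set S, bounded_borel A -> (nu A < +oo)%E.

Definition nonatomic (nu : {measure set (borelT S) -> \bar R}) : Prop :=
  forall x : S, nu [set x] = 0%E.

Definition is_counting (nu : {measure set (borelT S) -> \bar R}) : Prop :=
  bfinite nu /\
  forall A : set S, measurable (A : set (borelT S)) ->
    nu A = +oo%E \/ exists n : nat, nu A = (n%:R)%:E.

Definition disj_bounded_family (l : nat) (A : 'I_l -> set S) : Prop :=
  (forall i, bounded_borel (A i)) /\
  (forall i j, i != j -> A i `&` A j = set0).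

Definition point_process {d} {O : measurableType d} (P : probability O R)
    (N : O -> {measure set (borelT S) -> \bar R}) : Prop :=
  (forall w, is_counting (N w)) /\
  (forall A : set S, measurable (A : set (borelT S)) ->
     measurable_fun [set: O] ((fun w => N w A) : O -> \bar R)).

Definition gen_waring_process {d} {O : measurableType d} (P : probability O R)
    (N : O -> {measure set (borelT S) -> \bar R})
    (a rho k : R) (mu : {measure set (borelT S) -> \bar R}) : Prop :=
  point_process P N /\
  forall (l : nat) (A : 'I_l -> set S), disj_bounded_family A ->
  forall x : 'I_l -> nat,
    P [set w | forall i, N w (A i) = ((x i)%:R)%:E] =
    (mgwd_pmf a rho (fun i => k * fine (mu (A i))) x)%:E.

(** Negative binomial process with parameters a, c and parameter measure mu,
    given through its finite-dimensional probability generating functions. *)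
Definition neg_binomial_process {d} {O : measurableType d} (P : probability O R)
    (N : O -> {measure set (borelT S) -> \bar R})
    (a c : R) (mu : {measure set (borelT S) -> \bar R}) : Prop :=
  point_process P N /\
  forall (l : nat) (A : 'I_l -> set S), disj_bounded_family A ->
  forall z : 'I_l -> R, (forall i, `|z i| <= 1) ->
    (\int[P]_w (\prod_(i < l) z i ^+ cnt (N w (A i)))%:E)%E =
    ((1 + c^-1 * \sum_(i < l) (1 - z i) * fine (mu (A i))) `^ (- a))%:E.

Definition wsharp_cvg (nus : nat -> {measure set (borelT S) -> \bar R})
    (nu : {measure set (borelT S) -> \bar R}) : Prop :=
  forall f : S -> R, continuous f ->
    (exists M : R, forall x, `|f x| <= M) ->
    (exists B : set S, bounded_set B /\ forall x, ~ B x -> f x = 0) ->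
    ((fun n => \int[nus n]_x (f x)%:E) @ \oo --> \int[nu]_x (f x)%:E)%E.

(** Bounded continuous functionals on the space of boundedly finite counting
    measures with the w#-topology (continuity stated sequentially; this
    topology is metrizable). *)
Definition bcont_functional (F : {measure set (borelT S) -> \bar R} -> R) : Prop :=
  (exists M : R, forall nu, is_counting nu -> `|F nu| <= M) /\
  (forall nus nu, (forall n, is_counting (nus n)) -> is_counting nu ->
     wsharp_cvg nus nu -> F (nus n) @[n --> \oo] --> F nu).

Definition pp_weak_cvg {dO : nat -> measure_display}
    {O : forall k, measurableType (dO k)} (P : forall k, probability (O k) R)
    (N : forall k, O k -> {measure set (borelT S) -> \bar R})
    {d0} {O0 : measurableType d0} (P0 : probability O0 R)
    (N0 : O0 -> {measure set (borelT S) -> \bar R}) : Prop :=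
  forall F, bcont_functional F ->
    (forall k, measurable_fun setT (fun w => F (N k w))) ->
    measurable_fun setT (fun w => F (N0 w)) ->
    ((fun k => \int[P k]_w (F (N k w))%:E) @ \oo -->
       \int[P0]_w (F (N0 w))%:E)%E.

End Defs.

(* Main.v *)
(** Weak convergence follows from convergence of the finite-dimensional laws
without any tightness argument. Let V_0, V_1, ... be a countable base of bounded
open sets. Two counting measures having the same counts on all the atoms of
V_0, ..., V_(n-1) are close when n is large: counts being integers, the part of V_j
not covered by the V_i (i < n) on which a given test function oscillates little
eventually carries no point. Hence a nonnegative sequentially continuous functional
F is the pointwise limit of F_n(nu) = inf F(nu'), over the counting measures nu' with
the same atom counts as nu. As F_n <= F depends on finitely many counts,
liminf E F(N_k) >= E F(N); apply this to M + F and to M - F.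

The laws of the counts converge pointwise: those of N_k by Gamma(y+a) ~ y^a Gamma(y),
and those of N are identified by extracting the coefficients of the generating
function, one variable at a time. *)

Require Import Defs.
From HB Require Import structures.
From mathcomp Require Import all_boot all_order all_algebra.
From mathcomp Require Import all_classical all_reals all_analysis.
From mathcomp Require Import measurable_realfun.
From mathcomp Require Import ring lra.
Set Implicit Arguments. Unset Strict Implicit. Unset Printing Implicit Defensive.
Import Order.TTheory GRing.Theory Num.Theory.
Import numFieldNormedType.Exports.
Local Open Scope classical_set_scope.
Local Open Scope ring_scope.

(** * Atoms of a countable base of bounded sets *)

(** The obstacle is that a continuous functional depends on the whole measure, while convergence of
    the finite-dimensional laws controls only events fixed by finitely many counts. An infimum over
    a class of equal counts bridges the two: it is fixed by finitely many counts, and, being a lower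
    bound, it can be exchanged for the functional under [N k] at no cost. The quality of the
    approximation is thus measured only under the single law [P0], and no uniformity in [k] is
    called for; this is what replaces tightness. Nonnegativity serves twice: it bounds the infima
    below, and it allows large counts to be dropped, so that expectations become finite sums of
    probabilities. On the analytic side, the Waring mass contains four gamma values whose arguments
    are of order [k]. Only quotients of two values whose arguments differ by a fixed amount have a
    tractable growth, and that amount involves the real number [a]; hence the need for the
    asymptotics with a real shift. *)

(** The base consists of balls with centres in a dense sequence and positive rational radii, coded
    by natural numbers. Interiors are taken because a ball of a pseudometric structure need not be
    open. Arbitrarily large radii are included for the last clause, which places the support of a
    test function inside a single [V i]. *)
Lemma separable_bounded_base {R : realType} {S : completePseudoMetricType R} :
  (exists D : set S, countable D /\ dense D) ->
  exists V : nat -> set S, [/\ forall i, open (V i),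
    forall i, Defs.bounded_set (V i),
    forall x U, nbhs x U -> exists2 i, V i x & V i `<=` U &
    forall B, Defs.bounded_set B -> exists i, B `<=` V i].
Proof.
case=> D [/countable_injP[f finj] Ddense].
have [g gD] : exists g : nat -> S, forall d, D d -> exists i, g i = d.
  exists (fun i => if pselect (exists2 d, D d & f d = i) is left e
                   then sval (cid2 e) else point) => d Dd.
  exists (f d); case: pselect => [e|[]]; last by exists d.
  case: cid2 => d' /= Dd' /finj; apply; exact/mem_set.
have near_dense x (e : R) : 0 < e -> exists i, ball x e (g i).
  move=> e0; have /Ddense : (ball x e)^° !=set0.
    by exists x; apply: nbhsx_ballx.
  move=> /(_ (open_interior _)) [d [/interior_subset xd /gD [i gi]]].
  by exists i; rewrite gi.
pose dec n := odflt (0%N, 0%N, 0%N) (unpickle n : option (nat * nat * nat)).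
pose rad n : R := (dec n).1.2.+1%:R / (dec n).2.+1%:R.
have decE i p q : exists n, dec n = (i, p, q).
  by exists (pickle (i, p, q)); rewrite /dec pickleK.
exists (fun n => (ball (g (dec n).1.1) (rad n))^°); split.
- by move=> i; exact: open_interior.
- by move=> i; exists (g (dec i).1.1), (rad i); exact: interior_subset.
- move=> x U /nbhs_ballP[e /= e0 xeU].
  have [q qe] : exists q : nat, (q.+1%:R^-1 : R) < e / 2.
    have e20 : 0 < e / 2 by rewrite divr_gt0.
    exists (Num.bound (e / 2)^-1); rewrite invf_plt ?posrE//.
    apply: (lt_trans (archi_boundP _)); first by rewrite invr_ge0 ltW.
    by rewrite ltr_nat.
  set r : R := q.+1%:R^-1 in qe.
  have r0 : 0 < r by rewrite invr_gt0.
  have r20 : 0 < r / 2 by rewrite divr_gt0.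
  have [i xi] := near_dense x (r / 2) r20.
  have [n nE] := decE i 0%N q; exists n; rewrite /rad nE /= mul1r -/r.
    apply/nbhs_ballP; exists (r / 2) => //= y xy.
    by rewrite (splitr r); apply: ball_triangle xy; apply: ball_sym.
  move=> y /interior_subset iy; apply: xeU.
  apply: (@le_ball _ _ x (r / 2 + r)); last exact: ball_triangle iy.
  lra.
move=> B [x [r Br]].
have [i xi] := near_dense x 1 ltr01.
(* The radius is the bound of [r] plus 2: one unit for the distance from [x] to the centre, one to
   have room for the interior. *)
have [n nE] := decE i (Num.bound `|r|).+1 0%N; exists n; rewrite /rad nE /= divr1.
move=> y /Br xy; apply/nbhs_ballP; exists 1 => //= z yz.
have := ball_triangle (ball_triangle (ball_sym xi) xy) yz.
apply: le_ball; rewrite addrC addrA -[1 + 1]/(2%:R).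
have rb : r <= (Num.bound `|r|)%:R.
  by rewrite (le_trans (ler_norm _))// ltW// archi_boundP.
by rewrite -[X in _ <= X%:R]addn2 natrD addrC lerD2r.
Qed.

(** Signatures form a finite type; enumerating it indexes the atoms by an ordinal type, as
    [disj_bounded_family] requires. *)
Definition signature {T : Type} (V : nat -> set T) n (x : T) : {set 'I_n} :=
  finset (fun i : 'I_n => `[< V i x >]).

(* The empty signature is excluded: all atoms are then contained in some [V i],
   hence bounded. *)
Definition atom {T : Type} (V : nat -> set T) n (i : 'I_#|{: {set 'I_n}}|) : set T :=
  [set x | signature V n x = enum_val i /\ enum_val i != finset.set0].

Arguments signature {T} V n x.
Arguments atom {T} V n i.

Section atoms.
Context d (T : measurableType d) (R : realType) (V : nat -> set T) (n : nat).
Hypothesis mV : forall i, measurable (V i).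
Local Notation atom := (@atom T V n).
Local Notation sig := (signature V n).

Lemma measurable_signature (A : {set 'I_n}) : measurable [set x | sig x = A].
Proof.
have -> : [set x | sig x = A] =
    \bigcap_(i : 'I_n) (if i \in A then V i else ~` V i).
  apply/seteqP; split => x /=.
    move=> <- i _; rewrite inE; case: asboolP => //.
  move=> h; apply/setP => i; rewrite inE; have := h i I.
  by case: (i \in A) => [Vx|nVx]; [exact/asboolP|exact/negbTE/asboolPn].
apply: fin_bigcap_measurable => // i _.
by case: (i \in A); [exact: mV|apply: measurableC; exact: mV].
Qed.

Lemma measurable_atom i : measurable (atom i).
Proof.
have [e0|e0] := eqVneq (@enum_val _ (mem {: {set 'I_n}}) i) finset.set0.
  rewrite (_ : atom i = set0)//; apply/seteqP; split => x //= [].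
  by rewrite e0 eqxx.
rewrite (_ : atom i = [set x | sig x = enum_val i]); first exact: measurable_signature.
by apply/seteqP; split => x //= [].
Qed.

Lemma trivIset_atom (D : set 'I_#|{: {set 'I_n}}|) : trivIset D atom.
Proof.
move=> i j _ _ [x [[xi _] [xj _]]]; apply: enum_val_inj.
by rewrite -xi -xj.
Qed.

(** Points outside every [V i] have the empty signature and lie in no atom, hence the condition on
    [phi]. *)
Lemma atom_bigcup (phi : pred {set 'I_n}) : ~~ phi finset.set0 ->
  [set x | phi (sig x)] = \bigcup_(i in [set i | phi (enum_val i)]) atom i.
Proof.
move=> phi0; apply/seteqP; split => x /=.
  move=> px; exists (enum_rank (sig x)); rewrite /= ?enum_rankK//.
  split; rewrite enum_rankK//; apply: contra phi0 => /eqP <-; exact: px.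
by move=> [i /= phii [-> _]].
Qed.

Lemma eq_measure_atoms (nu nu' : {measure set T -> \bar R}) (phi : pred {set 'I_n}) :
  (forall i, nu (atom i) = nu' (atom i)) -> ~~ phi finset.set0 ->
  nu [set x | phi (sig x)] = nu' [set x | phi (sig x)].
Proof.
move=> e phi0; have mA i : measurable (atom i) by exact: measurable_atom.
have tA := trivIset_atom.
have fD : finite_set [set i : 'I_#|{: {set 'I_n}}| | phi (enum_val i)] by exact: finite_finset.
rewrite atom_bigcup//; rewrite (measure_fin_bigcup nu)//.
rewrite (measure_fin_bigcup nu')//; first by apply: eq_fsbigr => i _; exact: e.
Qed.

Lemma base_signatureE j (jn : (j < n)%N) : V j = [set x | Ordinal jn \in sig x].
Proof. by apply/seteqP; split => x /=; rewrite inE => /asboolP. Qed.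

(** Being decided by signatures, the uncovered part of [V j] is a union of atoms, so its mass is the
    same for two measures that agree on atoms. *)
Lemma residual_signatureE j (jn : (j < n)%N) (good : pred nat) :
  V j `\` \bigcup_(i in [set i | (i < n)%N && good i]) V i =
  [set x | (Ordinal jn \in sig x) && ~~ [exists i : 'I_n, (i \in sig x) && good i]].
Proof.
apply/seteqP; split => x /=; rewrite (base_signatureE jn) /=.
  move=> [jx ng]; apply/andP; split; first by [].
  apply/negP => /existsP[i /andP[]]; rewrite inE => /asboolP Vi gi.
  by apply: ng; exists i => //=; rewrite ltn_ord.
move=> /andP[jx ng]; split; first by [].
move=> [i /= /andP[ii gi] Vi]; move/negP : ng; apply; apply/existsP.
by exists (Ordinal ii); rewrite gi andbT inE; exact/asboolP.
Qed.

Lemma eq_measure_base (nu nu' : {measure set T -> \bar R}) j : (j < n)%N ->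
  (forall i, nu (atom i) = nu' (atom i)) -> nu (V j) = nu' (V j).
Proof.
move=> jn e; rewrite (base_signatureE jn).
by rewrite (@eq_measure_atoms nu nu' (fun A => Ordinal jn \in A))// inE.
Qed.

Lemma eq_measure_residual (nu nu' : {measure set T -> \bar R}) j (good : pred nat) :
  (j < n)%N -> (forall i, nu (atom i) = nu' (atom i)) ->
  nu (V j `\` \bigcup_(i in [set i | (i < n)%N && good i]) V i) =
  nu' (V j `\` \bigcup_(i in [set i | (i < n)%N && good i]) V i).
Proof.
move=> jn e; rewrite (residual_signatureE jn).
by rewrite (@eq_measure_atoms nu nu' (fun A => (Ordinal jn \in A) &&
  ~~ [exists i : 'I_n, (i \in A) && good i]))// inE.
Qed.

(* On an atom inside a good [V i], [f] varies by at most [2 * e], so [f] is squeezed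
   up to [2 * e] by a step function [g] whose integral is the same for [nu] and [nu'];
   the atoms of [V j] meeting no good [V i] are null. *)
Lemma le_integral_atoms (nu nu' : {measure set T -> \bar R}) (f : T -> R)
    (good : pred nat) (M e : R) (j : nat) :
  (forall i, nu (atom i) = nu' (atom i)) ->
  measurable_fun setT f -> (forall x, 0 <= f x) -> (forall x, f x <= M) ->
  (j < n)%N -> (forall x, ~ V j x -> f x = 0) -> 0 < e ->
  (forall i, good i -> forall x y, V i x -> V i y -> `|f x - f y| <= e) ->
  nu (V j `\` \bigcup_(i in [set i | (i < n)%N && good i]) V i) = 0%E ->
  (\int[nu']_x (f x)%:E <= \int[nu]_x (f x)%:E + (2 * e)%:E * nu (V j))%E.
Proof.
move=> eqA mf f0 fM jn fV e0 goodP Rem0.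
have M0 : 0 <= M by rewrite (le_trans (f0 point)).
pose j' := Ordinal jn.
pose isgood (A : {set 'I_n}) := [exists i : 'I_n, (i \in A) && good i].
pose Rem := [set x | (j' \in sig x) && ~~ isgood (sig x)].
have VjE : V j = [set x | j' \in sig x] by exact: base_signatureE.
have fz x (b : bool) : ~ V j x -> f x <= 0 + 2 * e * b%:R.
  by move=> /fV ->; rewrite add0r !mulr_ge0// ltW.
have [c cP] : exists c : 'I_#|{: {set 'I_n}}| -> R, forall i, 0 <= c i /\
    forall x, atom i x -> c i <= f x /\
      (~ Rem x -> f x <= c i + 2 * e * (j' \in sig x)%:R).
  suff : forall i, exists c : R, 0 <= c /\ forall x, atom i x -> c <= f x /\
      (~ Rem x -> f x <= c + 2 * e * (j' \in sig x)%:R).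
    by move=> h; have [c cP] := choice h; exists c.
  move=> i; have [[x0 x0i]|noti] := pselect (exists x, atom i x); last first.
    by exists 0; split => // x xi; exfalso; apply: noti; exists x.
  have [/existsP[k /andP[ki gk]]|ng] := boolP (isgood (enum_val i)).
    have [ji|ji] := boolP (j' \in (enum_val i : {set 'I_n})).
      (* Oscillation at most [e] around any point [x0] of the atom puts [f] between [f x0 - e] and
         [f x0 + e], whence the factor 2. The maximum with 0 keeps the step function nonnegative for
         the integration lemmas. *)
      exists (Num.max 0 (f x0 - e)); split; first by rewrite le_max lexx.
      have Vk x : atom i x -> V k x.
        by case => xi _; move: ki; rewrite -xi inE => /asboolP.
      move=> x xi; have := goodP _ gk _ _ (Vk _ xi) (Vk _ x0i).
      rewrite ler_norml => /andP[h1 h2]; split.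
        by rewrite ge_max f0 /=; lra.
      move=> _; case: (xi) => -> _; rewrite ji mulr1.
      have : f x0 - e <= Num.max 0 (f x0 - e) by rewrite le_max lexx orbT.
      lra.
    exists 0; split => // x xi; split => // _.
    apply: fz; rewrite VjE /=; case: xi => -> _; exact/negP.
  exists 0; split => // x xi; split => // nR.
  apply: fz; rewrite VjE /= => jx; apply: nR; rewrite /Rem /= jx /=.
  by case: xi => -> _.
pose g x := \sum_i c i * \1_(atom i) x.
have gE x : if sig x == finset.set0 then g x = 0
            else exists2 i, atom i x & g x = c i.
  case: ifPn => s0.
    rewrite /g big1// => i _; rewrite indicE memNset ?mulr0// => -[xi].
    by rewrite -xi s0.
  have xi : atom (enum_rank (sig x)) x by split; rewrite enum_rankK.
  exists (enum_rank (sig x)) => //; rewrite /g (bigD1 (enum_rank (sig x)))//=.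
  rewrite big1 ?addr0 ?indicE ?mem_set ?mulr1// => i ix.
  rewrite indicE memNset ?mulr0// => -[xi' _].
  by move/negP : ix; apply; apply/eqP; rewrite xi' enum_valK.
have gf x : g x <= f x.
  have := gE x; case: ifPn => [_ ->//|_ [i xi ->]].
  by have [_ /(_ _ xi)[]] := cP i.
(* The crude bound [M] is spent on [Rem] alone, which both measures neglect. *)
have fg x : f x <= g x + (2 * e * \1_(V j) x + M * \1_Rem x).
  have [xR|xR] := pselect (Rem x).
    rewrite [\1_Rem x]indicE mem_set// mulr1.
    have g0 : 0 <= g x.
      by rewrite sumr_ge0// => i _; rewrite mulr_ge0//; case: (cP i).
    rewrite (le_trans (fM x))// addrA lerDr addr_ge0//.
    by rewrite !mulr_ge0// ltW.
  rewrite [\1_Rem x]indicE memNset// mulr0 addr0 (_ : \1_(V j) x = (j' \in sig x)%:R); last first.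
    rewrite indicE; congr (_%:R); congr (nat_of_bool _).
    rewrite VjE; apply/idP/idP; first by move=> /set_mem.
    by move=> ?; apply/mem_set.
  have := gE x; case: ifPn => [/eqP s0 ->|_ [i xi ->]]; last first.
    by have [_ /(_ _ xi)[_]] := cP i; exact.
  by rewrite fV ?VjE /= s0 inE//= mulr0 addr0.
have mg1 i : measurable_fun setT (fun x => (c i * \1_(atom i) x)%:E).
  apply/measurable_EFinP; apply: measurable_funM => //.
  exact/measurable_indic/measurable_atom.
have g10 i x : (0 <= (c i * \1_(atom i) x)%:E)%E.
  by rewrite lee_fin mulr_ge0//; case: (cP i).
have intg (m : {measure set T -> \bar R}) :
    (\int[m]_x (g x)%:E = \sum_i (c i)%:E * m (atom i))%E.
  under eq_integral do rewrite /g -sumEFin.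
  rewrite ge0_integral_sum//; apply: eq_bigr => i _.
  under eq_integral do rewrite EFinM.
  rewrite ge0_integralZl_EFin//; last 2 first.
  - apply/measurable_EFinP; exact/measurable_indic/measurable_atom.
  - by case: (cP i).
  by rewrite integral_indic ?setIT//; exact: measurable_atom.
have mfE : measurable_fun setT (EFin \o f) by exact/measurable_EFinP.
have mg : measurable_fun setT (fun x => (g x)%:E).
  rewrite /g; under eq_fun do rewrite -sumEFin.
  exact: emeasurable_sum.
have g0 x : 0 <= g x.
  by rewrite sumr_ge0// => i _; rewrite mulr_ge0//; case: (cP i).
have mRem : measurable Rem.
  by rewrite /Rem -residual_signatureE; apply: measurableD => //; exact: bigcup_measurable.
have e20 : 0 <= 2 * e by rewrite mulr_ge0// ltW.
have mi (A : set T) (r : R) : measurable A ->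
    measurable_fun setT (fun x => (r * \1_A x)%:E).
  by move=> mA; apply/measurable_EFinP; apply: measurable_funM.
have inti (A : set T) (r : R) (m : {measure set T -> \bar R}) : 0 <= r ->
    measurable A -> (\int[m]_x (r * \1_A x)%:E = r%:E * m A)%E.
  move=> r0 mA; under eq_integral do rewrite EFinM.
  rewrite ge0_integralZl_EFin//; last exact/measurable_EFinP.
  by rewrite integral_indic ?setIT.
have ge1 (A : set T) (r : R) x : 0 <= r -> (0 <= (r * \1_A x)%:E)%E.
  by move=> r0; rewrite lee_fin mulr_ge0.
apply: (@le_trans _ _ (\int[nu']_x ((g x)%:E +
    ((2 * e * \1_(V j) x)%:E + (M * \1_Rem x)%:E)))%E).
  apply: ge0_le_integral => //.
  - by move=> x _; rewrite lee_fin.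
  - by apply: emeasurable_funD => //; apply: emeasurable_funD; exact: mi.
  - by move=> x _; rewrite -!EFinD lee_fin.
rewrite ge0_integralD//; last 3 first.
- by move=> x _; rewrite lee_fin.
- by move=> x _; rewrite adde_ge0// ge1.
- by apply: emeasurable_funD; exact: mi.
rewrite ge0_integralD//; [|by move=> x _; exact: ge1|exact: mi|
  by move=> x _; exact: ge1|exact: mi].
rewrite !inti//.
rewrite -(eq_measure_base jn eqA).
have -> : nu' Rem = 0%E.
  by rewrite /Rem -residual_signatureE -(eq_measure_residual _ jn eqA).
rewrite mule0 adde0 leeD2r//.
have -> : (\int[nu']_x (g x)%:E = \int[nu]_x (g x)%:E)%E.
  by rewrite !intg; apply: eq_bigr => i _; rewrite eqA.
by apply: ge0_le_integral => // x _; rewrite lee_fin.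
Qed.

End atoms.

(** * Convergence of counting measures with the same atom counts *)

Lemma cvge_approx {R : realType} (u : nat -> \bar R) (l : \bar R) :
  l \is a fin_num ->
  (forall e : R, 0 < e -> \forall n \near \oo,
     (u n <= l + e%:E)%E /\ (l <= u n + e%:E)%E) ->
  u @ \oo --> l.
Proof.
case: l => // r _ ul.
have ufin e n : (u n <= r%:E + e%:E)%E /\ (r%:E <= u n + e%:E)%E ->
    u n \is a fin_num.
  by case: (u n) => [?||] []//=; rewrite -?EFinD ?leye_eq ?leeNy_eq.
apply/fine_cvgP; split.
  by apply: filterS (ul 1 ltr01) => n; exact: ufin.
apply/cvgrPdist_le => e /ul; apply: filterS => n h.
have := ufin _ _ h; case: h; rewrite /=; case: (u n) => [x||]//.
by rewrite -!EFinD !lee_fin /= => h1 h2 _; rewrite ler_norml; apply/andP; split; lra.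
Qed.

Section point_measures.
Context {R : realType} {S : completePseudoMetricType R}.
Implicit Types nu : {measure set (borelT S) -> \bar R}.

Lemma open_borel (A : set S) : open A -> measurable (A : set (borelT S)).
Proof. by move=> oA; exact: sub_sigma_algebra. Qed.

Lemma continuous_borel_measurable (f : S -> R) :
  continuous f -> measurable_fun [set: borelT S] (f : borelT S -> R).
Proof.
move=> /continuousP cf; apply: (measurability _ (RGenOpens.measurableE R)).
move=> _ [_ [a [b ->] <-]]; rewrite setTI; apply: open_borel.
exact/cf/interval_open.
Qed.

Lemma counting_nat nu (A : set S) : is_counting nu -> bounded_borel A ->
  exists n : nat, nu A = n%:R%:E.
Proof.
move=> [nufin nuint] bA; have [mA _] := bA.
by have [h|//] := nuint _ mA; have := nufin _ bA; rewrite h ltxx.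
Qed.

Section base.
Variable V : nat -> set S.
Hypothesis oV : forall i, open (V i).
Hypothesis bV : forall i, Defs.bounded_set (V i).
Hypothesis baseV : forall x U, nbhs x U -> exists2 i, V i x & V i `<=` U.
Hypothesis coverV : forall B, Defs.bounded_set B -> exists i, B `<=` V i.

Let mV i : measurable (V i : set (borelT S)).
Proof. exact: open_borel. Qed.

Lemma bounded_borel_base i : bounded_borel (V i).
Proof. by split; [exact: mV|exact: bV]. Qed.

Lemma disj_bounded_atom n : disj_bounded_family (atom V n).
Proof.
split=> [i|i j ij].
  split; first exact: (@measurable_atom _ (borelT S)).
  have [[x [xi]]|none] := pselect (exists x, atom V n i x); last first.
    exists point, 0 => x xi; exfalso; apply: none; by exists x.
  move=> /set0Pn[k ki]; have [y [r Vr]] := bV k.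
  exists y, r => z [zi _]; apply: Vr.
  by move: ki; rewrite -zi inE => /asboolP.
apply/seteqP; split => x // -[[xi _] [xj _]].
by move/eqP: ij; apply; apply: enum_val_inj; rewrite -xi -xj.
Qed.

(** The residuals decrease to the empty set inside the bounded set [V j], so continuity from above
    sends their masses to 0; a natural number below 1 is 0. *)
Lemma residual_eventually0 nu j (good : pred nat) : is_counting nu ->
  V j `<=` \bigcup_(i in [set i | good i]) V i ->
  \forall n \near \oo,
    nu (V j `\` \bigcup_(i in [set i | (i < n)%N && good i]) V i) = 0%E.
Proof.
move=> cnu Vjg; pose F n := V j `\` \bigcup_(i in [set i | (i < n)%N && good i]) V i.
have mF n : measurable (F n : set (borelT S)).
  by apply: measurableD; [exact: mV|apply: bigcup_measurable => *; exact: mV].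
have bF n : bounded_borel (F n).
  split; first exact: mF.
  by have [y [r Vr]] := bV j; exists y, r => x [/Vr].
have F0 : \bigcap_n F n = set0.
  apply/seteqP; split => x // xF; have [Vx _] := xF 0%N I.
  have [i /= gi Vi] := Vjg _ Vx; have [_] := xF i.+1 I; apply.
  by exists i => //=; rewrite ltnSn.
have : nu \o F @ \oo --> nu (\bigcap_n F n).
  apply: nonincreasing_cvg_mu => //.
  - by have [+ _] := cnu; apply; exact: bF.
  - exact: bigcap_measurable.
  - move=> m n mn; apply/subsetPset => x [Vx nx]; split => // -[i /= /andP[im gi] Vi].
    by apply: nx; exists i => //=; rewrite gi (leq_trans im mn).
rewrite F0 measure0 => /fine_cvgP[_ /cvgrPdist_lt /(_ 1 ltr01)].
apply: filterS => n /=; have [k ->] := counting_nat cnu (bF n).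
rewrite sub0r normrN /= ger0_norm// => k1; congr EFin.
by move: k1; rewrite -[1]/(1%:R) ltr_nat ltnS leqn0 => /eqP ->.
Qed.

Section converge.
Variables (nus : nat -> {measure set (borelT S) -> \bar R}).
Variable nu : {measure set (borelT S) -> \bar R}.
Hypothesis cnu : is_counting nu.
Hypothesis eq_nu : forall n i, nus n (atom V n i) = nu (atom V n i).

(** [le_integral_atoms] is applied in both directions. Finiteness of the limit is recorded because
    positive and negative parts are subtracted afterwards. *)
Lemma ge0_wsharp_cvg_atoms (f : S -> R) (M : R) (j : nat) :
  continuous f -> (forall x, 0 <= f x) -> (forall x, f x <= M) ->
  (forall x, ~ V j x -> f x = 0) ->
  ((fun n => \int[nus n]_x (f x)%:E) @ \oo --> \int[nu]_x (f x)%:E)%E /\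
  (\int[nu]_x (f x)%:E)%E \is a fin_num.
Proof.
move=> cf f0 fM fV; have mf := continuous_borel_measurable cf.
have [q Vjq] := counting_nat cnu (bounded_borel_base j).
have M0 : 0 <= M by rewrite (le_trans (f0 point)).
have fin : (\int[nu]_x (f x)%:E)%E \is a fin_num.
  rewrite ge0_fin_numE; last by apply: integral_ge0 => x _; rewrite lee_fin.
  apply: (@le_lt_trans _ _ (M%:E * nu (V j))%E); last by rewrite Vjq -EFinM ltry.
  apply: (@le_trans _ _ (\int[nu]_x (M%:E * (\1_(V j) x)%:E))%E).
    apply: ge0_le_integral => //.
    - by move=> x _; rewrite lee_fin.
    - exact/measurable_EFinP.
    - by apply: measurable_funeM; apply/measurable_EFinP; exact: measurable_indic.
    - move=> x _; rewrite -EFinM lee_fin indicE.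
      have [Vx|Vx] := pselect (V j x); first by rewrite mem_set// mulr1.
      by rewrite memNset// mulr0 fV.
  rewrite ge0_integralZl_EFin//; last exact/measurable_EFinP/measurable_indic.
  by rewrite integral_indic ?setIT.
split=> //; apply: cvge_approx => // e e0.
(* The error is [2 * e'] for each of the [q] points of [nu] in [V j]; the added 1 covers [q = 0]. *)
pose e' := e / (2 * (q%:R + 1)).
have e'0 : 0 < e' by rewrite divr_gt0// mulr_gt0// ltr_wpDl.
have e'q : 2 * e' * q%:R <= e.
  have q1 : 0 < q%:R + 1 :> R by rewrite ltr_wpDl.
  have -> : 2 * e' * q%:R = e * (q%:R / (q%:R + 1)).
    by rewrite /e'; field; rewrite ?gt_eqF.
  by rewrite ler_piMr ?(ltW e0)// ler_pdivrMr// mul1r lerDl.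
pose good i := `[< forall x y, V i x -> V i y -> `|f x - f y| <= e' >].
have Vjg : V j `<=` \bigcup_(i in [set i | good i]) V i.
  move=> x _; have /cvgrPdist_lt /(_ (e' / 2)) := cf x.
  rewrite divr_gt0// => /(_ isT) /baseV[i Vix Vi]; exists i => //=.
  apply/asboolP => y z /Vi /= + /Vi /=.
  rewrite !ltr_norml ler_norml => /andP[? ?] /andP[? ?].
  by apply/andP; split; lra.
have := residual_eventually0 cnu Vjg; apply: filter_app.
exists j.+1 => // n /= jn Rem0.
have goodP i : good i -> forall x y, V i x -> V i y -> `|f x - f y| <= e'.
  by move/asboolP.
split.
  apply: (le_trans (le_integral_atoms mV (fun i => esym (eq_nu i)) mf f0 fM jn fV e'0 goodP Rem0)).
  by rewrite leeD2l// Vjq -EFinM lee_fin.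
(* The measures are exchanged: the residual is null for [nus n] too, as a union of atoms. *)
apply: (le_trans (le_integral_atoms mV (@eq_nu n) mf f0 fM jn fV e'0 goodP _)).
  by rewrite (eq_measure_residual mV good jn (@eq_nu n)).
by rewrite leeD2l// (eq_measure_base mV jn (@eq_nu n)) Vjq -EFinM lee_fin.
Qed.

Lemma wsharp_cvg_atoms : wsharp_cvg nus nu.
Proof.
move=> f cf [M fM] [B [bB fB]]; have [j BVj] := coverV bB.
have fV x : ~ V j x -> f x = 0 by move=> nV; apply: fB => /BVj.
have c0 : continuous (fun _ : S => 0 : R) by move=> x; exact: cvg_cst.
have cN : continuous (fun x => - f x) by move=> x; apply: cvgN; exact: cf.
have M0 : 0 <= M by rewrite (le_trans _ (fM point)).
have pos (g : S -> R) : continuous g -> (forall x, `|g x| <= M) ->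
    (forall x, ~ V j x -> g x = 0) ->
    ((fun n => \int[nus n]_x (Num.max (g x) 0)%:E) @ \oo -->
     \int[nu]_x (Num.max (g x) 0)%:E)%E /\
    (\int[nu]_x (Num.max (g x) 0)%:E)%E \is a fin_num.
  move=> cg gM gV; apply: (@ge0_wsharp_cvg_atoms _ M j).
  - by move=> x; apply: (@continuous_max _ _ g (fun=> 0)); [exact: cg|exact: c0].
  - by move=> x; rewrite le_max lexx orbT.
  - by move=> x; rewrite ge_max M0 andbT (le_trans (ler_norm _)).
  - by move=> x /gV ->; rewrite maxxx.
have [c1 f1] := pos f cf fM fV.
have [c2 f2] : _ /\ _ := pos (fun x => - f x) cN
  (fun x => etrans (congr1 (fun t => t <= M) (normrN _)) (fM x))
  (fun x Vx => etrans (congr1 _ (fV x Vx)) (oppr0 R)).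
have IE (m : {measure set (borelT S) -> \bar R}) : (\int[m]_x (f x)%:E =
    \int[m]_x (Num.max (f x) 0)%:E - \int[m]_x (Num.max (- f x) 0)%:E)%E.
  rewrite integralE; congr (_ - _)%E; apply: eq_integral => x _.
    by rewrite funeposE -EFin_max.
  by rewrite funenegE -EFinN -EFin_max.
rewrite IE; under eq_fun do rewrite IE.
by apply: cvgeB => //; rewrite fin_num_adde_defl// fin_numN.
Qed.

End converge.
End base.
End point_measures.

(** * From finite-dimensional laws to weak convergence *)

Lemma cvge_le_near {R : realType} (u : nat -> \bar R) (l : \bar R) (e : R) :
  u @ \oo --> l -> l \is a fin_num -> 0 < e -> \forall n \near \oo, (l <= u n + e%:E)%E.
Proof.
case: l => // r /fine_cvgP[uf /cvgrPdist_le ur] _ e0.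
near=> n; have : `|r - fine (u n)| <= e by near: n; exact: ur.
have : u n \is a fin_num by near: n.
case: (u n) => //= x _; rewrite ler_norml -EFinD lee_fin => /andP[? ?]; lra.
Unshelve. all: by end_near. Qed.

Section bounded_expectation.
Context d (T : measurableType d) (R : realType) (P : probability T R).
Implicit Types f : T -> R.

Lemma bounded_integrable f (M : R) : measurable_fun setT f ->
  (forall w, `|f w| <= M) -> P.-integrable setT (EFin \o f).
Proof.
move=> mf fM; have := finite_measure_integrable_cst P M measurableT.
apply: le_integrable => //; first exact/measurable_EFinP.
by move=> w _ /=; rewrite lee_fin (le_trans (fM w))// ler_norm.
Qed.

Lemma bounded_cvg_integral (h : nat -> T -> R) f (M : R) :
  (forall n, measurable_fun setT (h n)) -> (forall n w, `|h n w| <= M) ->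
  (forall w, h n w @[n --> \oo] --> f w) ->
  (\int[P]_w (h n w)%:E @[n --> \oo] --> \int[P]_w (f w)%:E)%E.
Proof.
move=> mh hM hf.
apply: (@dominated_cvg _ _ _ P setT measurableT (fun n w => (h n w)%:E)
  (fun w => (f w)%:E) (EFin \o cst M)).
- by move=> n; exact/measurable_EFinP.
- by move=> w _; apply: cvg_EFin; [exact: nearW|exact: hf].
- by [].
- exact: finite_measure_integrable_cst.
- by move=> n w _; rewrite lee_fin.
Qed.

End bounded_expectation.

(** * Lower envelopes of a functional over classes of equal counts *)

Section cylinders.
Context {R : realType} {S : completePseudoMetricType R}.
Implicit Types nu : {measure set (borelT S) -> \bar R}.
Local Notation meas := {measure set (borelT S) -> \bar R}.

Definition cylinder {O : Type} (N : O -> meas) l (A : 'I_l -> set S) (x : 'I_l -> nat) :=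
  [set w | forall i, N w (A i) = (x i)%:R%:E].

Lemma measurable_cylinder d (O : measurableType d) (P : probability O R) (N : O -> meas)
    l (A : 'I_l -> set S) x :
  point_process P N -> disj_bounded_family A -> measurable (cylinder N A x).
Proof.
move=> [_ mN] [bA _].
rewrite (_ : cylinder _ _ _ = \bigcap_(i : 'I_l) ((fun w => N w (A i)) @^-1` [set (x i)%:R%:E])).
  apply: fin_bigcap_measurable => // i _.
  rewrite -[X in measurable X]setTI; apply: mN => //.
  exact: (bA i).1.
by apply/seteqP; split => w h i; [move=> _|]; exact: h.
Qed.

Lemma count_cnt nu A : is_counting nu -> bounded_borel A -> nu A = (cnt (nu A))%:R%:E.
Proof.
by move=> cnu bA; have [n ->] := counting_nat cnu bA; rewrite /cnt /= natrK.
Qed.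

Section envelope.
Variable F : meas -> R.
Hypothesis F0 : forall nu, is_counting nu -> 0 <= F nu.
Variables (l : nat) (A : 'I_l -> set S).
Hypothesis dA : disj_bounded_family A.

Let class x := [set F nu | nu in [set nu | is_counting nu /\ forall i, nu (A i) = (x i)%:R%:E]].

(* Junk value [inf set0 = 0] when no counting measure has the counts [x]. *)
Definition envelope (x : 'I_l -> nat) : R := inf (class x).

Lemma envelope_ge0 x : 0 <= envelope x.
Proof.
rewrite /envelope; have [->|/set0P ne] := eqVneq (class x) set0; first by rewrite inf0.
by apply: lb_le_inf => // _ [nu [cnu _] <-]; exact: F0.
Qed.

Let has_inf_class nu x : is_counting nu -> (forall i, nu (A i) = (x i)%:R%:E) ->
  has_inf (class x).
Proof.
move=> cnu e; split; first by exists (F nu); exists nu.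
by exists 0 => _ [nu' [cnu' _] <-]; exact: F0.
Qed.

Lemma envelope_le nu x : is_counting nu -> (forall i, nu (A i) = (x i)%:R%:E) ->
  envelope x <= F nu.
Proof.
by move=> cnu e; apply: ge_inf; [have [] := has_inf_class cnu e|exists nu].
Qed.

(** The infimum need not be attained. Near-minimisers, one per level [n], will form the sequence
    along which continuity of [F] is tested. *)
Lemma envelope_approx nu x (e : R) : is_counting nu ->
  (forall i, nu (A i) = (x i)%:R%:E) -> 0 < e ->
  exists nu', [/\ is_counting nu', forall i, nu' (A i) = nu (A i) & F nu' <= envelope x + e].
Proof.
move=> cnu nux e0; have [_ [nu' [cnu' nux'] <-] h] := inf_adherent e0 (has_inf_class cnu nux).
by exists nu'; split=> [//|i|]; [rewrite nux' nux|exact: ltW].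
Qed.

Definition envelope_count (nu : meas) : R := envelope (fun i => cnt (nu (A i))).

Lemma envelope_count_bound nu : is_counting nu -> 0 <= envelope_count nu <= F nu.
Proof.
move=> cnu; rewrite envelope_ge0 envelope_le// => i.
by apply: count_cnt => //; case: dA => + _.
Qed.

(** This keeps the envelope where all counts are below [m] and is 0 elsewhere. Only finitely many
    classes remain, so its expectation is a finite combination of cylinder probabilities, and
    convergence of these suffices. *)
Definition truncated_envelope (m : nat) (nu : meas) : R :=
  \sum_(x : {ffun 'I_l -> 'I_m})
    envelope (fun i => x i) * `[< forall i, nu (A i) = (nat_of_ord (x i))%:R%:E >]%:R.

Lemma truncated_envelope_ge0 m nu : 0 <= truncated_envelope m nu.
Proof. by apply: sumr_ge0 => x _; rewrite mulr_ge0// envelope_ge0. Qed.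

Lemma truncated_envelopeE m nu (x : {ffun 'I_l -> 'I_m}) :
  (forall i, nu (A i) = (nat_of_ord (x i))%:R%:E) ->
  truncated_envelope m nu = envelope (fun i => x i).
Proof.
move=> nux; rewrite /truncated_envelope (bigD1 x)//= big1 ?addr0.
  by rewrite asboolT// mulr1.
move=> y yx; rewrite asboolF ?mulr0// => nuy; move/eqP : yx; apply.
apply/ffunP => i; apply/val_inj/eqP; rewrite -(eqr_nat R); apply/eqP.
by apply: EFin_inj; rewrite -nux -nuy.
Qed.

Lemma truncated_envelope_le m nu : is_counting nu -> truncated_envelope m nu <= F nu.
Proof.
move=> cnu; have [[x nux]|none] := pselect (exists x : {ffun 'I_l -> 'I_m},
    forall i, nu (A i) = (nat_of_ord (x i))%:R%:E).
  by rewrite (truncated_envelopeE nux); exact: envelope_le.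
rewrite /truncated_envelope big1 ?F0// => x _; rewrite asboolF ?mulr0// => nux.
by apply: none; exists x.
Qed.

Lemma truncated_envelope_cvg nu : is_counting nu ->
  truncated_envelope m nu @[m --> \oo] --> envelope_count nu.
Proof.
move=> cnu; apply: cvg_near_cst.
pose c i := cnt (nu (A i)).
exists (\max_i c i).+1 => // m /= cm.
have clt i : (c i < m)%N.
  by apply: leq_trans cm; rewrite ltnS; exact: (leq_bigmax i).
rewrite (@truncated_envelopeE m nu [ffun i => Ordinal (clt i)]); last first.
  by move=> i; rewrite ffunE /=; apply: count_cnt => //; case: dA => + _.
by congr (envelope _); apply/funext => i; rewrite ffunE.
Qed.

Section process.
Context d (O : measurableType d) (P : probability O R) (N : O -> meas).
Hypothesis ppN : point_process P N.

Lemma truncated_envelope_indic m w : truncated_envelope m (N w) =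
  \sum_(x : {ffun 'I_l -> 'I_m}) envelope (fun i => x i) * \1_(cylinder N A (fun i => x i)) w.
Proof.
by apply: eq_bigr => x _; rewrite indicE; congr (_ * (nat_of_bool _)%:R).
Qed.

Lemma measurable_truncated_envelope m :
  measurable_fun setT (fun w => truncated_envelope m (N w)).
Proof.
under eq_fun do rewrite truncated_envelope_indic.
apply: measurable_sum => x; apply: measurable_funM => //.
exact/measurable_indic/(measurable_cylinder _ ppN).
Qed.

Lemma integral_truncated_envelope m :
  (\int[P]_w (truncated_envelope m (N w))%:E =
   \sum_(x : {ffun 'I_l -> 'I_m}) (envelope (fun i => x i))%:E * P (cylinder N A (fun i => x i)))%E.
Proof.
under eq_integral do rewrite truncated_envelope_indic -sumEFin.
have mc (x : {ffun 'I_l -> 'I_m}) : measurable (cylinder N A (fun i => x i)).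
  exact: (measurable_cylinder _ ppN).
rewrite ge0_integral_sum//; last 2 first.
- move=> x; apply/measurable_EFinP; apply: measurable_funM => //.
- by move=> x w _; rewrite lee_fin mulr_ge0// envelope_ge0.
apply: eq_bigr => x _.
under eq_integral do rewrite EFinM.
rewrite ge0_integralZl_EFin//; last 2 first.
- exact/measurable_EFinP/measurable_indic.
- exact: envelope_ge0.
by rewrite integral_indic ?setIT.
Qed.

(** An infimum over an uncountable class gives no measurability directly; it comes from the
    truncations, which are simple functions and are eventually equal to the envelope at each
    point. *)
Lemma measurable_envelope_count : measurable_fun setT (fun w => envelope_count (N w)).
Proof.
apply: (measurable_fun_cvg measurable_truncated_envelope) => w _.
by apply: truncated_envelope_cvg; case: ppN.
Qed.

End process.
End envelope.
End cylinders.

(** * The liminf inequality and weak convergence *)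

Section fidi_to_weak.
Context {R : realType} {S : completePseudoMetricType R}.
Local Notation meas := {measure set (borelT S) -> \bar R}.
Hypothesis S_separable : exists D : set S, countable D /\ dense D.
Variables (dO : nat -> measure_display) (O : forall k, measurableType (dO k))
  (P : forall k, probability (O k) R) (N : forall k, O k -> meas)
  (d0 : measure_display) (O0 : measurableType d0) (P0 : probability O0 R)
  (N0 : O0 -> meas).
Arguments N : clear implicits.
Hypothesis ppN : forall k, (0 < k)%N -> point_process (P k) (N k).
Hypothesis ppN0 : point_process P0 N0.
Hypothesis fidi : forall l (A : 'I_l -> set S), disj_bounded_family A ->
  forall x : 'I_l -> nat,
  (P k (cylinder (N k) A x) @[k --> \oo] --> P0 (cylinder N0 A x))%E.

(** Three errors of [e / 3] add up: from [F] to its envelope at level [n] and from there to the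
    truncation at [m], both under [P0], then from [P0] to [P k] in a finite sum with [n] and [m]
    fixed. Returning to [F] under [P k] is free, since the truncated envelope is below [F]. *)
Lemma liminf_functional (F : meas -> R) (M : R) :
  (forall nu, is_counting nu -> 0 <= F nu) ->
  (forall nu, is_counting nu -> F nu <= M) ->
  (forall nus nu, (forall n, is_counting (nus n)) -> is_counting nu ->
     wsharp_cvg nus nu -> F (nus n) @[n --> \oo] --> F nu) ->
  (forall k, measurable_fun setT (fun w => F (N k w))) ->
  measurable_fun setT (fun w => F (N0 w)) ->
  forall e : R, 0 < e -> \forall k \near \oo,
    (\int[P0]_w (F (N0 w))%:E <= \int[P k]_w (F (N k w))%:E + e%:E)%E.
Proof.
move=> F0 FM Fcont mF mF0 e e0; have e30 : 0 < e / 3 by rewrite divr_gt0.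
have [V [oV bV baseV coverV]] := separable_bounded_base S_separable.
pose A n := atom V n; have dA n : disj_bounded_family (A n) by exact: disj_bounded_atom.
have c0 w : is_counting (N0 w) by case: ppN0.
pose H n w := envelope_count F (A n) (N0 w).
have Hb n w : 0 <= H n w <= F (N0 w) by exact: envelope_count_bound.
have HcvgF w : H n w @[n --> \oo] --> F (N0 w).
  (* The minimiser of level [n] has slack [1 / (n + 1)] and the atom counts of [N0 w] at that level,
     so these measures converge to [N0 w] and squeeze [H n w]. *)
  have ex n : exists nu', [/\ is_counting nu', forall i, nu' (A n i) = N0 w (A n i)
      & F nu' <= H n w + n.+1%:R^-1].
    apply: envelope_approx => //.
    by move=> i; apply: count_cnt => //; case: (dA n) => + _.
  have [nus nusP] := choice ex.
  have Fnus : F (nus n) @[n --> \oo] --> F (N0 w).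
    apply: Fcont => //; first by move=> n; case: (nusP n).
    apply: (wsharp_cvg_atoms oV bV baseV coverV) => // n i.
    by case: (nusP n) => _ + _; apply.
  apply: (@squeeze_cvgr _ _ _ _ (fun n => F (nus n) - n.+1%:R^-1) (fun=> F (N0 w))).
  - near=> n; have [_ _ h] := nusP n; have /andP[_ h2] := Hb n w.
    by rewrite h2 andbT lerBlDr.
  - rewrite -[X in _ --> X]subr0; apply: cvgB => //; exact: cvg_harmonic.
  - exact: cvg_cst.
have mH n : measurable_fun setT (H n) by exact: (measurable_envelope_count F (dA n) ppN0).
have FMw w : F (N0 w) <= M by exact: FM.
have HM n w : `|H n w| <= M.
  by have /andP[h1 h2] := Hb n w; rewrite ger0_norm// (le_trans h2).
have fin (g : O0 -> R) : measurable_fun setT g -> (forall w, `|g w| <= M) ->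
    (\int[P0]_w (g w)%:E)%E \is a fin_num.
  by move=> mg gM; apply: integrable_fin_num => //; exact: bounded_integrable mg gM.
have FMa w : `|F (N0 w)| <= M by rewrite ger0_norm ?F0.
have := cvge_le_near (bounded_cvg_integral (P:=P0) mH HM HcvgF) (fin _ mF0 FMa) e30.
case=> n _ /(_ n (leqnn n)) /= h1.
pose g m w := truncated_envelope F (A n) m (N0 w).
have mg m : measurable_fun setT (g m).
  exact: (measurable_truncated_envelope F (dA n) ppN0 m).
have gM m w : `|g m w| <= M.
  rewrite ger0_norm ?truncated_envelope_ge0//.
  by rewrite (le_trans (truncated_envelope_le F0 (A n) m (c0 w))).
have gcvg w : g m w @[m --> \oo] --> H n w.
  exact: truncated_envelope_cvg.
have := cvge_le_near (bounded_cvg_integral (P:=P0) mg gM gcvg) (fin _ (mH n) (HM n)) e30.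
case=> m _ /(_ m (leqnn m)) /= h2.
have kcvg : (\sum_(x : {ffun 'I__ -> 'I_m}) (envelope F (A n) (fun i => x i))%:E *
      P k (cylinder (N k) (A n) (fun i => x i)) @[k --> \oo] -->
    \int[P0]_w (g m w)%:E)%E.
  rewrite (integral_truncated_envelope F0 (dA n) ppN0).
  apply: cvg_nnesum => x _.
    by apply: nearW => k; rewrite mule_ge0// lee_fin envelope_ge0.
  by apply: cvgeZl => //; exact: fidi.
have := cvge_le_near kcvg (fin _ (mg m) (gM m)) e30.
apply: filter_app; exists 1%N => // k /= k0 h3.
have ppk := ppN k0.
have h4 : (\int[P k]_w (truncated_envelope F (A n) m (N k w))%:E <=
    \int[P k]_w (F (N k w))%:E)%E.
  have ck w : is_counting (N k w) by case: ppk.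
  apply: ge0_le_integral => //.
  - by move=> w _; rewrite lee_fin truncated_envelope_ge0.
  - apply/measurable_EFinP; exact: (measurable_truncated_envelope F (dA n) ppk m).
  - exact/measurable_EFinP.
  - by move=> w _; rewrite lee_fin truncated_envelope_le.
rewrite (integral_truncated_envelope F0 (dA n) ppk) in h4.
rewrite (_ : e%:E = (e / 3)%:E + (e / 3)%:E + (e / 3)%:E)%E; last first.
  by rewrite -!EFinD; congr EFin; field.
rewrite !addeA.
apply: (le_trans h1); apply: leeD => //; apply: (le_trans h2); apply: leeD => //.
by apply: (le_trans h3); apply: leeD.
Unshelve. all: by end_near. Qed.

Lemma weak_cvg_of_fidi : pp_weak_cvg P N P0 N0.
Proof.
move=> F [[M FM] Fcont] mF mF0.
have c0 w : is_counting (N0 w) by case: ppN0.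
have I0 : P0.-integrable setT (EFin \o (fun w => F (N0 w))).
  by apply: (@bounded_integrable _ _ _ _ _ M) => // w; exact: FM.
have fin0 := integrable_fin_num measurableT I0.
have Ik k : (0 < k)%N -> (P k).-integrable setT (EFin \o (fun w => F (N k w))).
  move=> k0; apply: (@bounded_integrable _ _ _ _ _ M) => // w; apply: FM.
  by case: (ppN k0).
have intD d (Q : measurableType d) (P' : probability Q R) (f : Q -> R) :
    P'.-integrable setT (EFin \o f) ->
    (\int[P']_w (f w + M)%:E = \int[P']_w (f w)%:E + M%:E)%E.
  move=> If; under eq_integral do rewrite EFinD.
  rewrite integralD//; last exact: finite_measure_integrable_cst.
  by rewrite integral_cst// [X in (_ * X)%E]probability_setT mule1.
have intN d (Q : measurableType d) (P' : probability Q R) (f : Q -> R) :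
    P'.-integrable setT (EFin \o f) ->
    (\int[P']_w (- f w + M)%:E = - (\int[P']_w (f w)%:E) + M%:E)%E.
  move=> If; rewrite intD; last exact: integrableN If.
  under eq_integral do rewrite EFinN.
  by rewrite integralN//; exact: integrable_add_def.
have FMb nu : is_counting nu -> -M <= F nu <= M by move=> /FM; rewrite ler_norml.
apply: cvge_approx => // e e0.
have up : \forall k \near \oo, (\int[P0]_w (F (N0 w) + M)%:E <=
    \int[P k]_w (F (N k w) + M)%:E + e%:E)%E.
  apply: (@liminf_functional (fun nu => F nu + M) (M + M)) => //.
  - by move=> nu /FMb /andP[? ?]; lra.
  - by move=> nu /FMb /andP[? ?]; lra.
  - by move=> nus nu cn c /(Fcont _ _ cn c) h; apply: cvgD => //; exact: cvg_cst.
  - by move=> k; apply: measurable_funD.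
  - exact: measurable_funD.
have lo : \forall k \near \oo, (\int[P0]_w (- F (N0 w) + M)%:E <=
    \int[P k]_w (- F (N k w) + M)%:E + e%:E)%E.
  apply: (@liminf_functional (fun nu => - F nu + M) (M + M)) => //.
  - by move=> nu /FMb /andP[? ?]; lra.
  - by move=> nu /FMb /andP[? ?]; lra.
  - move=> nus nu cn c /(Fcont _ _ cn c) h.
    by apply: cvgD; [exact: cvgN|exact: cvg_cst].
  - by move=> k; apply: measurable_funD => //; exact: measurableT_comp.
  - by apply: measurable_funD => //; exact: measurableT_comp.
near=> k; have k0 : (0 < k)%N by near: k; exists 1%N.
have fink := integrable_fin_num measurableT (Ik _ k0).
have hup : (\int[P0]_w (F (N0 w) + M)%:E <=
    \int[P k]_w (F (N k w) + M)%:E + e%:E)%E by near: k.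
have hlo : (\int[P0]_w (- F (N0 w) + M)%:E <=
    \int[P k]_w (- F (N k w) + M)%:E + e%:E)%E by near: k.
move: hup hlo; rewrite (intN _ _ _ _ I0) (intN _ _ _ _ (Ik _ k0)).
rewrite (intD _ _ _ _ I0) (intD _ _ _ _ (Ik _ k0)).
move: fin0 fink; rewrite /comp; case: (integral P0 _ _) => // r0 _.
case: (integral _ _ _) => // rk _.
by rewrite -!EFinN -!EFinD !lee_fin => h1 h2; split; lra.
Unshelve. all: by end_near. Qed.

End fidi_to_weak.

(** * Counts of the negative binomial process *)

Section power_series.
Context {R : realType}.
Implicit Types (p : nat -> R) (t K M : R).

(** Abel's comparison with a geometric series of ratio [|t| / K]. *)
Lemma is_cvg_pseries_bounded p K M t : 0 < K -> (forall n, `|p n * K ^+ n| <= M) ->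
  `|t| < K -> cvgn (pseries p t).
Proof.
move=> K0 pM tK; apply: normed_cvg.
have tK1 : `| `|t| / K | < 1.
  by rewrite (ger0_norm (divr_ge0 (normr_ge0 t) (ltW K0))) ltr_pdivrMr// mul1r.
apply: (@series_le_cvg _ _ (geometric M (`|t| / K))).
- by move=> n; exact: normr_ge0.
- move=> n; have M0 : 0 <= M by exact: le_trans (pM 0%N).
  by rewrite /geometric /= mulr_ge0// exprn_ge0// divr_ge0// ltW.
- move=> n; rewrite /geometric /= normrM normrX.
  rewrite exprMn exprVn mulrA.
  rewrite ler_pdivlMr ?exprn_gt0// mulrAC ler_wpM2r ?exprn_ge0//.
  by rewrite (le_trans _ (pM n))// normrM (ger0_norm (exprn_ge0 _ (ltW K0))).
exact: is_cvg_geometric_series.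
Qed.

Lemma bernoulli_ineq (d : R) n : 0 <= d -> 1 + n%:R * d <= (1 + d) ^+ n.
Proof.
move=> d0; elim: n => [|n ih]; first by rewrite expr0 mul0r addr0.
rewrite exprS (le_trans _ (ler_wpM2l _ ih)) ?addr_ge0//.
have : 0 <= n%:R * (d * d) by rewrite !mulr_ge0.
by rewrite -natr1; nra.
Qed.

(** Take radii [|t| < K < L < 1]. The terms [p n * L ^+ n] are bounded, and by Bernoulli's
    inequality the factor [n + 1] is absorbed by the growth of [(L / K) ^+ n]. *)
Lemma is_cvg_pseries_diffs p : (forall t, `|t| < 1 -> cvgn (pseries p t)) ->
  forall t, `|t| < 1 -> cvgn (pseries (pseries_diffs p) t).
Proof.
move=> pc t t1; pose K := (`|t| + 1) / 2; pose L := (K + 1) / 2.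
have t0 : 0 <= `|t| by exact: normr_ge0.
have tK : `|t| < K by rewrite /K; lra.
have K0 : 0 < K by rewrite (le_lt_trans _ tK).
have KL : K < L by rewrite /L /K; lra.
have L0 : 0 < L by rewrite (lt_trans K0).
have L1 : `|L| < 1 by rewrite gtr0_norm// /L /K; lra.
clearbody L; clearbody K.
have /cvg_series_cvg_0 pL0 := pc L L1.
have [M M0 pM] : exists2 M, 0 <= M & forall n, `|p n * L ^+ n| <= M.
  have /cvg_seq_bounded[M [_ h]] := cvgP _ pL0.
  exists (`|M| + 1) => [|n]; first by rewrite addr_ge0.
  by apply: (h (`|M| + 1)) => //; rewrite (le_lt_trans (ler_norm M))// ltrDl.
pose d := L / K - 1.
have d0 : 0 < d by rewrite subr_gt0 ltr_pdivlMr// mul1r.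
have LE : L = K * (1 + d) by rewrite /d; field; rewrite gt_eqF.
apply: (@is_cvg_pseries_bounded _ K ((1 + d^-1) * (M / L))) => // n.
rewrite /pseries_diffs normrM [`|_ ^+ _|]gtr0_norm ?exprn_gt0// normrM normr_nat.
have := pM n.+1; rewrite normrM [`|_ ^+ _|]gtr0_norm ?exprn_gt0// => pMn.
rewrite mulrA ler_pdivlMr//.
have h1 : n.+1%:R * K ^+ n <= (1 + d^-1) * L ^+ n.
  rewrite LE exprMn [leLHS]mulrC [leRHS]mulrCA ler_pM2l ?exprn_gt0//.
  rewrite (le_trans _ (ler_wpM2l _ (bernoulli_ineq n (ltW d0)))) ?addr_ge0 ?invr_ge0 ?(ltW d0)//.
  have -> : (1 + d^-1) * (1 + n%:R * d) = 1 + n%:R + (d^-1 + n%:R * d).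
    by field; rewrite gt_eqF.
  have : 0 <= d^-1 + n%:R * d by rewrite addr_ge0 ?mulr_ge0 ?invr_ge0 ?(ltW d0).
  by rewrite -natr1 [n%:R + 1]addrC lerDl.
have -> : n.+1%:R * `|p n.+1| * K ^+ n * L = (n.+1%:R * K ^+ n) * (L * `|p n.+1|) by ring.
rewrite (le_trans (ler_wpM2r _ h1)) ?mulr_ge0 ?(ltW L0)//.
rewrite -mulrA ler_wpM2l ?addr_ge0 ?invr_ge0 ?(ltW d0)//.
by rewrite mulrA -exprSr mulrC.
Qed.

(* Differentiating replaces [(C, al)] by [(C * al * b, al + 1)] and [p] by
   [pseries_diffs p], so that the coefficient is read off at [t = 0]. *)
Lemma coef_negative_binomial x p (C al be b : R) : 0 <= b -> b < be ->
  (forall t, `|t| < 1 -> pseries p t @ \oo --> C * (be - t * b) `^ (- al)) ->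
  p x = C * \prod_(j < x) (al + j%:R) * b ^+ x * be `^ (- (al + x%:R)) / x`!%:R.
Proof.
move=> b0 bbe; have be0 : 0 < be by rewrite (le_lt_trans b0).
elim: x p C al => [|x ih] p C al pC.
  rewrite big_ord0 fact0 divr1 expr0 !mulr1 addr0.
  have := pC 0; rewrite normr0 ltr01 mul0r subr0 => /(_ isT) /cvg_lim <-//.
  apply/esym/cvg_lim => //; apply: cvg_near_cst; exists 1%N => // n /= n0.
  rewrite /pseries /series /= big_ltn// expr0 mulr1 big1_seq ?addr0// => i.
  by rewrite mem_index_iota => /andP[_ /andP[i0 _]]; rewrite expr0n gtn_eqF// mulr0.
have pc t : `|t| < 1 -> cvgn (pseries p t) by move=> /pC /cvgP.
have pc' := is_cvg_pseries_diffs pc; have pc'' := is_cvg_pseries_diffs pc'.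
have pd t : `|t| < 1 -> pseries (pseries_diffs p) t @ \oo -->
    C * al * b * (be - t * b) `^ (- (al + 1)).
  move=> t1; pose K := (`|t| + 1) / 2.
  have t0 : 0 <= `|t| by exact: normr_ge0.
  have K0 : 0 < K by rewrite /K; lra.
  have tK : `|t| < `|K| by rewrite (gtr0_norm K0) /K; lra.
  have K1 : `|K| < 1 by rewrite (gtr0_norm K0) /K; lra.
  (* Termwise differentiation at [t] uses convergence of the series and of its first two derived
     series at a point [K] beyond [t]. *)
  have D1 := pseries_snd_diffs (pc _ K1) (pc' _ K1) (pc'' _ K1) tK.
  have tb : 0 < be - t * b.
    have : t * b <= 1 * b by rewrite ler_wpM2r// ltW// (le_lt_trans (ler_norm _)).
    lra.
  have D2 : is_derive t 1 (fun t => C * (be - t * b) `^ (- al))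
      (C * al * b * (be - t * b) `^ (- (al + 1))).
    have Dp := is_derive1_powR (- al) tb.
    have Dl : is_derive t 1 (fun t => be - t * b) (- b).
      apply: is_derive_eq; rewrite /GRing.scale /=; ring.
    have Dc := is_derive1_comp (f:=@powR R ^~ (- al)) (g:=fun t => be - t * b) Dp Dl.
    have DZ := is_deriveZ C Dc.
    refine (is_derive_eq DZ _); rewrite /GRing.scale /= opprD; ring.
  suff <- : limn (pseries (pseries_diffs p) t) =
    C * al * b * (be - t * b) `^ (- (al + 1)) by exact: pc'.
  rewrite -(@derive_val _ _ _ _ _ _ _ D1) -(@derive_val _ _ _ _ _ _ _ D2).
  apply: near_eq_derive => //.
  near=> s; apply/cvg_lim => //; apply: pC.
  near: s; exact: (cvgr_lt _ (@norm_continuous _ R^o t)).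
have := ih _ _ _ pd; rewrite /pseries_diffs => h.
have x1 : x.+1%:R != 0 :> R by rewrite pnatr_eq0.
apply: (mulfI x1); rewrite h big_ord_recl /= addr0 factS natrM exprS.
have -> : \prod_(i < x) (al + 1 + i%:R) = \prod_(i < x) (al + (bump 0 i)%:R).
  by apply: eq_bigr => i _; rewrite /bump /= add1n -natr1 -addrA [1 + _]addrC.
have -> : al + 1 + x%:R = al + x.+1%:R by rewrite -natr1 -addrA [1 + _]addrC.
by field; rewrite [1 + _]addrC natr1 x1 andbT pnatr_eq0 -lt0n fact_gt0.
Unshelve. all: by end_near. Qed.

End power_series.

(** The weight [Y] carries the other variables: as a function of [t] the expectation is a power
    series with coefficients E[Y; X = m], which [coef_negative_binomial] then reads off. *)
Lemma pgf_coef d (T : measurableType d) (R : realType) (P : probability T R)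
    (Y : T -> R) (X : T -> nat) (M C al be b : R) (x : nat) :
  measurable_fun setT Y -> (forall w, `|Y w| <= M) ->
  (forall m, measurable [set w | X w = m]) -> 0 <= b -> b < be ->
  (forall t, `|t| < 1 ->
    (\int[P]_w (Y w * t ^+ X w)%:E)%E = (C * (be - t * b) `^ (- al))%:E) ->
  (\int[P]_w (Y w * (X w == x)%:R)%:E)%E =
  (C * \prod_(j < x) (al + j%:R) * b ^+ x * be `^ (- (al + x%:R)) / x`!%:R)%:E.
Proof.
move=> mY YM mX b0 bbe pgf.
have mI m : measurable_fun setT (fun w => Y w * (X w == m)%:R).
  apply: measurable_funM => //.
  rewrite (_ : (fun w => _) = \1_[set w | X w = m]); first exact: measurable_indic.
  apply/funext => w; rewrite indicE; congr (nat_of_bool _)%:R.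
  by apply/eqP/idP => [?|/set_mem//]; exact/mem_set.
have YI m w : `|Y w * (X w == m)%:R| <= M.
  rewrite normrM (le_trans _ (YM w))// normr_nat.
  by case: eqP => _; rewrite ?mulr1// mulr0.
have iI m : P.-integrable setT (EFin \o (fun w => Y w * (X w == m)%:R)).
  exact: bounded_integrable (mI m) (YI m).
pose p m := fine (\int[P]_w (Y w * (X w == m)%:R)%:E)%E.
have pE m : (p m)%:E = (\int[P]_w (Y w * (X w == m)%:R)%:E)%E.
  by rewrite fineK//; exact: integrable_fin_num (iI m).
rewrite -pE; congr EFin; apply: coef_negative_binomial => // t t1.
(* The partial sum equals [Y w * t ^+ X w] cut off at [X w < n], so it is bounded by [M] uniformly
   in [n] and dominated convergence applies. *)
pose h n w := \sum_(0 <= m < n) Y w * (X w == m)%:R * t ^+ m.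
have hE n w : h n w = Y w * t ^+ X w * (X w < n)%:R.
  rewrite /h; case: ltnP => Xn.
    rewrite (bigD1_seq (X w)) ?mem_index_iota ?iota_uniq//= eqxx !mulr1 big1 ?addr0// => m mX'.
    by rewrite (negbTE (_ : X w != m)) ?mulr0 ?mul0r// eq_sym.
  rewrite mulr0 big1_seq// => m; rewrite mem_index_iota => /andP[_ /= mn].
  by rewrite gtn_eqF ?mulr0 ?mul0r// (leq_trans mn).
have M0 : 0 <= M by rewrite (le_trans _ (YM point)).
have tX w : `|Y w * t ^+ X w| <= M.
  rewrite normrM (le_trans _ (YM w))// ler_piMr// normrX exprn_ile1// ltW//.
have mh n : measurable_fun setT (h n).
  by apply: measurable_sum => m; apply: measurable_funM.
have hM n w : `|h n w| <= M.
  rewrite hE normrM (le_trans _ (tX w))// normr_nat.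
  by case: ltnP => _; rewrite ?mulr1// mulr0.
have hc w : h n w @[n --> \oo] --> Y w * t ^+ X w.
  apply: cvg_near_cst; exists (X w).+1 => // n /= Xn.
  by rewrite hE Xn mulr1.
have := bounded_cvg_integral (P:=P) mh hM hc; rewrite pgf// => /fine_cvgP[_].
apply: cvg_trans; apply: near_eq_cvg; apply: nearW => n /=.
rewrite /pseries /series /= /h.
under eq_integral do rewrite -sumEFin.
rewrite integral_sum//; last first.
  move=> m; under eq_fun do rewrite mulrC EFinM.
  by apply: integrableZl => //; exact: iI.
rewrite (eq_bigr (fun m => (p m * t ^+ m)%:E)); last first.
  move=> m _; under eq_integral do rewrite mulrC EFinM.
  by rewrite integralZl//; [rewrite -pE -EFinM mulrC|exact: iI].
by rewrite sumEFin.
Qed.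

(** The gamma-mixed Poisson mass: independent Poisson counts of means [L * m i], integrated over [L]
    with the gamma law of shape [a] and rate [c]. The second product is Gamma(a + X) / Gamma(a),
    with X the total count. *)
Definition neg_binomial_pmf {R : realType} (a c : R) l (m : 'I_l -> R) (x : 'I_l -> nat) : R :=
  c `^ a * \prod_(i < l) (m i ^+ x i / (x i)`!%:R) *
  \prod_(j < (\sum_(i < l) x i)%N) (a + j%:R) *
  (c + \sum_(i < l) m i) `^ (- (a + (\sum_(i < l) x i)%N%:R)).

Lemma big_ord_addn_prod {R : comNzRingType} (f : nat -> R) n m :
  \prod_(j < (n + m)%N) f j = \prod_(j < n) f j * \prod_(j < m) f (n + j)%N.
Proof. by rewrite big_split_ord. Qed.

Lemma neg_binomial_fidi {R : realType} {S : completePseudoMetricType R}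
    d (O : measurableType d) (P : probability O R)
    (N : O -> {measure set (borelT S) -> \bar R}) (a c : R)
    (mu : {measure set (borelT S) -> \bar R}) l (A : 'I_l -> set S) (x : 'I_l -> nat) :
  0 < a -> 0 < c -> neg_binomial_process P N a c mu -> disj_bounded_family A ->
  P (cylinder N A x) = (neg_binomial_pmf a c (fun i => fine (mu (A i))) x)%:E.
Proof.
move=> a0 c0 [ppN pgf] dA.
pose m i := fine (mu (A i)); have m0 i : 0 <= m i by rewrite fine_ge0.
pose X i w := cnt (N w (A i)).
have NX i w : N w (A i) = (X i w)%:R%:E.
  by apply: count_cnt; [case: ppN|case: dA].
have mX i n : measurable [set w | X i w = n].
  rewrite (_ : [set w | _] = cylinder N (fun _ : 'I_1 => A i) (fun _ => n)).
    apply: (measurable_cylinder _ ppN); split; first by move=> _; case: dA.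
    by move=> j k; rewrite !ord1 eqxx.
  apply/seteqP; split => w /=; first by move=> Xn j; rewrite NX Xn.
  by move=> /(_ ord0); rewrite NX => -[] /eqP; rewrite eqr_nat => /eqP.
pose B := c + \sum_i m i.
(* [D] is the set of the variables whose coefficient has already been extracted. *)
pose f (D : {set 'I_l}) (z : 'I_l -> R) i w : R :=
  if i \in D then (X i w == x i)%:R else z i ^+ X i w.
have fb D z i w : (forall i, `|z i| <= 1) -> `|f D z i w| <= 1.
  move=> z1; rewrite /f; case: ifP => _; first by case: eqP; rewrite ?normr1 ?normr0.
  by rewrite normrX exprn_ile1.
have mI i n : measurable_fun setT (fun w => (X i w == n)%:R : R).
  rewrite (_ : (fun w => _) = \1_[set w | X i w = n]); first exact: measurable_indic.
  apply/funext => w; rewrite indicE; congr (nat_of_bool _)%:R.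
  by apply/eqP/idP => [?|/set_mem//]; exact/mem_set.
have mf D z i : measurable_fun setT (f D z i).
  rewrite /f; case: (i \in D) => //.
  pose h n w : R := \sum_(k < n) z i ^+ k * (X i w == k)%:R.
  apply: (@measurable_fun_cvg _ _ _ setT h) => [n|w _].
    by apply: measurable_sum => k; apply: measurable_funM.
  apply: cvg_near_cst; exists (X i w).+1 => // n /= Xn.
  rewrite /h (bigD1 (Ordinal Xn))//= eqxx mulr1 big1 ?addr0// => k kX.
  rewrite (negbTE (_ : X i w != k)) ?mulr0// eq_sym.
  by apply: contra kX => /eqP kX; apply/eqP/val_inj.
pose xs (D : {set 'I_l}) := (\sum_(i in D) x i)%N.
(* Extracting one coefficient preserves the form C (be - t b)^(-al) in each remaining variable: the
   exponent grows by [x i0] and [z i0] leaves the base. Hence [pgf_coef] applies at every step of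
   the induction on the size of [D]. *)
have main (D : {set 'I_l}) z : (forall i, `|z i| <= 1) ->
    (\int[P]_w (\prod_i f D z i w)%:E)%E =
    (c `^ a * \prod_(i in D) (m i ^+ x i / (x i)`!%:R) * \prod_(j < xs D) (a + j%:R) *
     (B - \sum_(i | i \notin D) z i * m i) `^ (- (a + (xs D)%:R)))%:E.
  have [n] := ubnP #|D|; elim: n D z => // n ih D z Dn z1.
  have [->|[i0 i0D]] := set_0Vmem D.
    rewrite /xs !big_set0 big_ord0 !mulr1 addr0.
    under eq_integral => w _.
      under eq_bigr => i _ do rewrite /f inE.
      over.
    rewrite pgf//; congr EFin.
    under [X in B - X]eq_bigl do rewrite inE.
    have zm : \sum_i z i * m i <= \sum_i m i.
      apply: ler_sum => i _; rewrite ler_piMl// (le_trans (ler_norm _))//.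
    have ca : c^-1 `^ (- a) = c `^ a by rewrite -(powR_inv1 (ltW c0)) -powRrM mulN1r opprK.
    rewrite -ca -powRM ?invr_ge0 ?(ltW c0)//; last by rewrite /B; lra.
    congr (_ `^ _); rewrite /B -addrA -sumrB mulrDr mulVf ?gt_eqF//.
    congr (1 + _ * _).
    by apply: eq_bigr => i _; rewrite mulrBl mul1r.
  pose D' := D :\ i0.
  have DE : D = i0 |: D' by rewrite finset.setD1K.
  have i0D' : i0 \notin D' by rewrite !inE eqxx.
  have D'n : (#|D'| < n)%N.
    by move: Dn; rewrite DE cardsU1 i0D' add1n ltnS.
  pose Y w := \prod_(i | i != i0) f D z i w.
  have fE z' w : (forall i, i != i0 -> z' i = z i) ->
      \prod_i f D' z' i w = Y w * z' i0 ^+ X i0 w.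
    move=> zz'; rewrite (bigD1 i0)//= mulrC /f (negbTE i0D'); congr (_ * _).
    by apply: eq_bigr => i ii0; rewrite /f DE !inE ii0 /= (negbTE ii0) /= zz'.
  have -> : (\int[P]_w (\prod_i f D z i w)%:E = \int[P]_w (Y w * (X i0 w == x i0)%:R)%:E)%E.
    apply: eq_integral => w _; congr EFin; rewrite (bigD1 i0)//= mulrC.
    by congr (_ * _); rewrite /f i0D.
  have mY : measurable_fun setT Y.
    rewrite /Y; under eq_fun do rewrite big_mkcond.
    by apply: measurable_prod => i _; case: (i != i0).
  have Y1 w : `|Y w| <= 1.
    by rewrite normr_prod; apply: prodr_ile1 => i _; rewrite normr_ge0 fb.
  pose be := B - \sum_(i | i \notin D) z i * m i.
  (* Since [z i <= 1], the other variables remove at most their own [m i] from [B]; what is left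
     contains [m i0] and the positive [c]. *)
  have mbe : m i0 < be.
    rewrite /be /B (bigD1 i0)//=.
    have : \sum_(i | i \notin D) z i * m i <= \sum_(i | i != i0) m i.
      rewrite [leRHS](bigID (fun i => i \notin D))/= ler_wpDr ?sumr_ge0//.
      rewrite [leRHS](eq_bigl (fun i => i \notin D)); last first.
        by move=> i; rewrite andb_idl//; apply: contra => /eqP ->.
      by apply: ler_sum => i _; rewrite ler_piMl// (le_trans (ler_norm _)).
    by lra.
  rewrite (@pgf_coef _ _ _ P Y (X i0) 1 (c `^ a * \prod_(i in D') (m i ^+ x i / (x i)`!%:R) *
      \prod_(j < xs D') (a + j%:R)) (a + (xs D')%:R) be (m i0) (x i0))//; last first.
    move=> t t1; pose z' i := if i == i0 then t else z i.
    have z'1 i : `|z' i| <= 1 by rewrite /z'; case: eqP => // _; rewrite ltW.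
    have := ih D' z' D'n z'1.
    under eq_integral => w _.
      rewrite fE; last by move=> i /negbTE ii0; rewrite /z' ii0.
      rewrite /z' eqxx; over.
    move=> ->; congr (_ * _ `^ _)%:E.
    have -> : \sum_(i | i \notin D') z' i * m i = t * m i0 + \sum_(i | i \notin D) z i * m i.
      rewrite (bigD1 i0)//= {1}/z' eqxx; congr (_ + _).
      apply: eq_big => [i|i /andP[_ /negbTE ii0]]; last by rewrite /z' ii0.
      by rewrite /D' !inE; case: eqP => [->|_]; rewrite ?i0D ?andbF ?andbT.
    by rewrite /be opprD addrA addrAC.
  congr EFin.
  have xsD : xs D = (xs D' + x i0)%N by rewrite /xs DE big_setU1//= addnC.
  rewrite xsD (big_ord_addn_prod (fun j => a + j%:R)) DE big_setU1//= -DE natrD addrA.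
  have -> : \prod_(j < x i0) (a + (xs D' + j)%:R) = \prod_(j < x i0) (a + (xs D')%:R + j%:R).
    by apply: eq_bigr => j _; rewrite natrD addrA.
  rewrite -/be; ring.
have := main finset.setT (fun _ => 0) (fun _ => eq_ind_r (fun t => t <= 1) ler01 (normr0 _)).
rewrite /neg_binomial_pmf -/B /xs.
rewrite [X in B - X]big1 ?subr0; last by move=> i; rewrite inE.
rewrite !(eq_bigl _ _ (fun i => finset.in_setT i)) => <-.
have -> : P (cylinder N A x) = (\int[P]_w (\1_(cylinder N A x) w)%:E)%E.
  by rewrite integral_indic ?setIT//; exact: (measurable_cylinder _ ppN).
apply: eq_integral => w _; congr EFin.
rewrite indicE; have [h|h] := pselect (cylinder N A x w).
  rewrite mem_set// big1// => i _; rewrite /f inE.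
  have /eqP := h i; rewrite NX eqe eqr_nat => ->.
  by [].
rewrite memNset//; apply/esym/eqP; rewrite prodf_seq_eq0; apply/hasP.
have [i Xi] : exists i, X i w != x i.
  apply: contrapT => none; apply: h => i; rewrite NX; congr (_%:R%:E).
  by apply: contrapT => Xi; apply: none; exists i; exact/eqP.
by exists i; rewrite ?mem_index_enum//= /f inE (negbTE Xi).
Qed.

(** * The gamma function *)

Section gamma.
Context {R : realType}.
Implicit Types (x y a s t : R).
Local Notation leb := (@lebesgue_measure R).

Definition gamma_integrand x t : R := t `^ (x - 1) * expR (- t).
Definition gamma_integral x : \bar R :=
  (\int[leb]_(t in `]0%R, +oo[%classic) (gamma_integrand x t)%:E)%E.

Lemma gamma_integrand_ge0 x t : 0 <= gamma_integrand x t.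
Proof. by rewrite mulr_ge0 ?powR_ge0 ?expR_ge0. Qed.

Lemma measurable_gamma_integrand x (D : set R) :
  measurable_fun D (EFin \o gamma_integrand x).
Proof.
apply/measurable_EFinP; apply: measurable_funM.
  by apply: measurable_funTS; exact: measurable_powR.
apply: measurable_funTS; apply: measurableT_comp; first exact: measurable_expR.
exact: oppr_measurable.
Qed.

Lemma gamma_integral_ge0 x : (0 <= gamma_integral x)%E.
Proof. by apply: integral_ge0 => t _; rewrite lee_fin gamma_integrand_ge0. Qed.

Lemma integral_expRN a :
  (\int[leb]_(t in `[a, +oo[%classic) (expR (- t))%:E = (expR (- a))%:E)%E.
Proof.
have dE t : is_derive t 1 (fun t => - expR (- t)) (expR (- t)).
  apply: is_derive_eq; rewrite /GRing.scale /=; ring.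
have cE : continuous (fun t : R => expR (- t)).
  by move=> t; apply: continuous_comp; [exact: opp_continuous|exact: continuous_expR].
rewrite (@ge0_continuous_FTC2y _ _ (fun t => - expR (- t)) a 0).
- by rewrite -EFinB sub0r opprK.
- by move=> t _; exact: expR_ge0.
- exact: continuous_subspaceT.
- rewrite -oppr0; apply: cvgN; exact: cvgr_expR.
- by move=> t _; have [] := dE t.
- by apply: cvgN; apply: cvg_at_right_filter; exact: cE.
- by move=> t _; rewrite derive1E; have [_ ->] := dE t.
Qed.

Let I_ n : set R := `[n.+2%:R^-1, n.+2%:R]%classic.

Let I_lt n : n.+2%:R^-1 < n.+2%:R :> R.
Proof. by rewrite (@lt_trans _ _ 1)// ?invf_lt1 ?ltr1n. Qed.

Let cvg_I x : (\int[leb]_(t in I_ n) (gamma_integrand x t)%:E @[n --> \oo] -->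
  gamma_integral x)%E.
Proof.
have -> : gamma_integral x = (\int[leb]_(t in \bigcup_n I_ n) (gamma_integrand x t)%:E)%E.
  congr (integral _ _ _); apply/seteqP; split => t /=.
    rewrite in_itv/= andbT => t0; pose n := Num.bound (t + t^-1).
    have tn : t + t^-1 < n.+2%:R.
      rewrite (lt_trans (archi_boundP _)) ?addr_ge0 ?invr_ge0 ?(ltW t0)//.
      by rewrite ltr_nat.
    have ti : 0 < t^-1 by rewrite invr_gt0.
    exists n => //; rewrite /I_ /= in_itv/=; apply/andP; split; last by lra.
    rewrite -[leRHS]invrK lef_pV2 ?posrE//; lra.
  by move=> [n _]; rewrite /I_ /= !in_itv/= andbT => /andP[+ _]; exact: lt_le_trans.
apply: ge0_nondecreasing_set_cvg_integral.
- apply/nondecreasing_seqP => n; apply/subsetPset => t; rewrite /I_ /= !in_itv/=.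
  move=> /andP[h1 h2]; rewrite (le_trans _ h1) ?(le_trans h2)//= ?ler_nat//.
  by rewrite lef_pV2 ?posrE// ler_nat.
- by move=> n; exact: measurable_itv.
- by move=> n; exact: measurable_gamma_integrand.
- by move=> n t _; rewrite lee_fin gamma_integrand_ge0.
Qed.

(** The boundary term is added on the left so that the limit involves no difference of integrals,
    whose finiteness is not yet known. *)
Let by_parts x n : 0 < x ->
  (\int[leb]_(t in I_ n) (gamma_integrand (x + 1) t)%:E +
   (n.+2%:R `^ x * expR (- n.+2%:R) - n.+2%:R^-1 `^ x * expR (- n.+2%:R^-1))%:E =
   x%:E * \int[leb]_(t in I_ n) (gamma_integrand x t)%:E)%E.
Proof.
move=> x0; have a0 : 0 < n.+2%:R^-1 :> R by rewrite invr_gt0.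
have dF t : 0 < t -> is_derive t 1 (fun t => t `^ x) (x * t `^ (x - 1)).
  by move=> t0; exact: is_derive1_powR.
have dG t : is_derive t 1 (fun t => - expR (- t)) (expR (- t)).
  apply: is_derive_eq; rewrite /GRing.scale /=; ring.
have cG : continuous (fun t : R => expR (- t)).
  by move=> t; apply: continuous_comp; [exact: opp_continuous|exact: continuous_expR].
have cP y t : 0 < t -> {for t, continuous (fun t => t `^ y)}.
  move=> t0; apply: differentiable_continuous; apply/derivable1_diffP.
  by have [] := is_derive1_powR y t0.
have Ipos t : t \in (I_ n) -> 0 < t.
  by rewrite inE /I_ /= in_itv/= => /andP[+ _]; exact: lt_le_trans.
have e : (\int[leb]_(t in I_ n) (t `^ x * expR (- t))%:E =
    (n.+2%:R `^ x * - expR (- n.+2%:R) - n.+2%:R^-1 `^ x * - expR (- n.+2%:R^-1))%:E -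
    \int[leb]_(t in I_ n) (x * t `^ (x - 1) * - expR (- t))%:E)%E.
  apply: (@integration_by_parts R (fun t => t `^ x) (fun t => - expR (- t))
    (fun t => x * t `^ (x - 1)) (fun t => expR (- t)) _ _ (I_lt n)).
  - apply: continuous_in_subspaceT => t /Ipos t0.
    by apply: cvgM; [exact: cvg_cst|exact: cP].
  - split.
    + move=> t; rewrite in_itv/= => /andP[/(lt_trans a0) t0 _].
      by have [] := dF _ t0.
    + by apply: cvg_at_right_filter; exact: cP.
    + by apply: cvg_at_left_filter; exact: cP.
  - move=> t; rewrite in_itv/= => /andP[/(lt_trans a0) t0 _].
    by rewrite derive1E; have [_ ->] := dF _ t0.
  - exact: continuous_subspaceT.
  - split.
    + by move=> t _; have [] := dG t.
    + by apply: cvgN; apply: cvg_at_right_filter; exact: cG.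
    + by apply: cvgN; apply: cvg_at_left_filter; exact: cG.
  - by move=> t _; rewrite derive1E; have [_ ->] := dG t.
have -> : (\int[leb]_(t in I_ n) (gamma_integrand (x + 1) t)%:E =
    \int[leb]_(t in I_ n) (t `^ x * expR (- t))%:E)%E.
  by apply: eq_integral => t _; rewrite /gamma_integrand addrK.
rewrite e.
have -> : (\int[leb]_(t in I_ n) (x * t `^ (x - 1) * - expR (- t))%:E =
    - (x%:E * \int[leb]_(t in I_ n) (gamma_integrand x t)%:E))%E.
  rewrite -ge0_integralZl_EFin//; last 4 first.
  - exact: measurable_itv.
  - by move=> t _; rewrite lee_fin gamma_integrand_ge0.
  - exact: measurable_gamma_integrand.
  - exact: ltW.
  rewrite -integral_ge0N; last first.
    by move=> t _; rewrite -EFinM lee_fin mulr_ge0 ?gamma_integrand_ge0// ltW.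
  by apply: eq_integral => t _; rewrite -EFinM -EFinN /gamma_integrand mulrN mulrA.
rewrite oppeK addeAC -EFinD [X in X%:E](_ : _ = 0); last by ring.
by rewrite add0e.
Qed.


Let cvg_top x : (n.+2%:R `^ x * expR (- n.+2%:R) : R) @[n --> \oo] --> (0 : R).
Proof.
(* An integer [k] above [x]: the bound e^y >= y^(k+1) / (k+1)! then leaves at most (k+1)! / y. *)
pose k := (Num.bound `|x|).+1.
have xk : x <= k%:R.
  rewrite (le_trans (ler_norm _))// ltW// (lt_trans (archi_boundP _))//.
  by rewrite /k ltr_nat.
apply: (@squeeze_cvgr _ _ _ _ (fun=> 0) (fun n => k.+1`!%:R * n.+1%:R^-1)).
- apply: nearW => n; rewrite mulr_ge0 ?powR_ge0 ?expR_ge0//=.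
  have n1 : 1 <= n.+2%:R :> R by rewrite ler1n.
  rewrite expRN ler_pdivrMr ?expR_gt0//.
  rewrite (le_trans (ler_powR n1 xk))// powR_mulrn//.
  have := @expR_ge1Dxn R n.+2%:R k (ler0n _ _).
  move=> h; have {}h : n.+2%:R ^+ k.+1 / k.+1`!%:R <= expR n.+2%:R :> R by lra.
  rewrite ler_pdivrMr in h; last by rewrite ltr0n fact_gt0.
  rewrite mulrAC ler_pdivlMr// [leRHS]mulrC (le_trans _ h)// exprSr.
  by rewrite ler_wpM2l ?exprn_ge0// ler_nat.
- exact: cvg_cst.
- by rewrite -[X in _ --> X](mulr0 k.+1`!%:R); apply: cvgMr; exact: cvg_harmonic.
Qed.

Let cvg_bot x : 0 < x -> (n.+2%:R^-1 `^ x * expR (- n.+2%:R^-1) : R) @[n --> \oo] --> (0 : R).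
Proof.
move=> x0.
have h0 : (n.+2%:R^-1 : R) @[n --> \oo] --> 0^'+.
  move=> U [e /= e0 eU]; have /cvgrPdist_lt/(_ _ e0) := @cvg_harmonic R.
  apply: filterS => n /= hn; apply: eU => //=.
  rewrite sub0r normrN ger0_norm ?invr_ge0// (le_lt_trans _ hn)// sub0r normrN.
  by rewrite ger0_norm ?invr_ge0// lef_pV2 ?posrE// ler_nat.
apply: (@squeeze_cvgr _ _ _ _ (fun=> 0) (fun n => n.+2%:R^-1 `^ x)).
- apply: nearW => n; rewrite mulr_ge0 ?powR_ge0 ?expR_ge0//=.
  by rewrite ler_piMr ?powR_ge0// expR_le1 oppr_le0 invr_ge0.
- exact: cvg_cst.
- exact: cvg_comp h0 (powR_cvg0 x0).
Qed.

Lemma gamma_integralD1 x : 0 < x ->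
  gamma_integral (x + 1) = (x%:E * gamma_integral x)%E.
Proof.
move=> x0.
have h1 : (x%:E * \int[leb]_(t in I_ n) (gamma_integrand x t)%:E @[n --> \oo] -->
    x%:E * gamma_integral x)%E by apply: cvgeZl => //; exact: cvg_I.
have h2 : (\int[leb]_(t in I_ n) (gamma_integrand (x + 1) t)%:E +
   (n.+2%:R `^ x * expR (- n.+2%:R) - n.+2%:R^-1 `^ x * expR (- n.+2%:R^-1))%:E
    @[n --> \oo] --> gamma_integral (x + 1) + 0%:E)%E.
  apply: cvgeD; [by rewrite fin_num_adde_defl|exact: cvg_I|].
  apply: cvg_EFin; first exact: nearW.
  by rewrite -[X in _ --> X]subr0; apply: cvgB; [exact: cvg_top|exact: cvg_bot].
rewrite adde0 in h2; apply: (cvg_unique _ _ h1) => //.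
by apply: cvg_trans h2; apply: near_eq_cvg; apply: nearW => n; exact: by_parts.
Qed.

Lemma gamma_integral1 : gamma_integral 1 = 1%E.
Proof.
rewrite /gamma_integral integral_itv_obnd_cbnd; last exact: measurable_gamma_integrand.
rewrite -[RHS](_ : (expR (- 0))%:E = _); last by rewrite oppr0 expR0.
rewrite -integral_expRN; apply: eq_integral => t _.
by rewrite /gamma_integrand subrr powRr0 mul1r.
Qed.

Let gamma_integral_nat n : gamma_integral n.+1%:R \is a fin_num.
Proof.
elim: n => [|n ih]; first by rewrite gamma_integral1.
by rewrite -natr1 gamma_integralD1// fin_numM.
Qed.

(** For [y >= 1], t^(y-1) is at most 1 + t^n with [n] an integer above [y - 1], and integer
    arguments follow by recursion from 1. Smaller [x] are reached through the functional equation,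
    which was proved in the extended reals for this purpose. *)
Lemma gamma_integral_fin_num x : 0 < x -> gamma_integral x \is a fin_num.
Proof.
have ge1 y : 1 <= y -> gamma_integral y \is a fin_num.
  move=> y1; pose n := Num.bound `|y|.
  have yn : y - 1 <= n%:R.
    by rewrite lerBlDr (le_trans (ler_norm _))// (le_trans (ltW (archi_boundP _)))// lerDl.
  rewrite ge0_fin_numE ?gamma_integral_ge0//.
  apply: (@le_lt_trans _ _ (gamma_integral 1 + gamma_integral n.+1%:R)%E); last first.
    by rewrite gamma_integral1 lte_add_pinfty ?ltry// -ge0_fin_numE ?gamma_integral_ge0 ?gamma_integral_nat.
  rewrite -ge0_integralD//; first last.
  - exact: measurable_gamma_integrand.
  - by move=> t _; rewrite lee_fin gamma_integrand_ge0.
  - exact: measurable_gamma_integrand.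
  - by move=> t _; rewrite lee_fin gamma_integrand_ge0.
  apply: ge0_le_integral => //.
  - by move=> t _; rewrite lee_fin gamma_integrand_ge0.
  - exact: measurable_gamma_integrand.
  - by apply: emeasurable_funD; exact: measurable_gamma_integrand.
  move=> t /=; rewrite in_itv/= andbT => t0; rewrite -EFinD lee_fin /gamma_integrand.
  rewrite -mulrDl ler_wpM2r ?expR_ge0// subrr powRr0 -natr1 addrK.
  have [t1|t1] := leP t 1.
    rewrite (@le_trans _ _ 1) ?lerDl ?powR_ge0// -[leRHS](powRr0 t).
    by apply: ger_powR; rewrite ?t0// subr_ge0.
  by rewrite (le_trans (ler_powR (ltW t1) yn))// lerDr.
move=> x0; have : gamma_integral (x + 1) \is a fin_num by apply: ge1; lra.
rewrite gamma_integralD1//; have := gamma_integral_ge0 x.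
by case: (gamma_integral x) => //=; rewrite mulry gtr0_sg// mul1e.
Qed.

Lemma GammaE x : 0 < x -> (Gamma x)%:E = gamma_integral x.
Proof. by move=> x0; rewrite -[RHS]fineK ?gamma_integral_fin_num. Qed.

Lemma GammaD1 x : 0 < x -> Gamma (x + 1) = x * Gamma x.
Proof.
by move=> x0; apply: EFin_inj; rewrite EFinM !GammaE ?gamma_integralD1// ltr_wpDl// ltW.
Qed.

Lemma Gamma_gt0 x : 0 < x -> 0 < Gamma x.
Proof.
have ge1 y : 1 <= y -> 0 < Gamma y.
  move=> y1; have y0 : 0 < y by rewrite (lt_le_trans _ y1).
  rewrite -lte_fin GammaE//.
  apply: (@lt_le_trans _ _ (expR (- 1))%:E); first by rewrite lte_fin expR_gt0.
  rewrite -integral_expRN.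
  apply: (@le_trans _ _ (\int[leb]_(t in `[1%R, +oo[%classic) (gamma_integrand y t)%:E)%E).
    apply: ge0_le_integral => //; try by move=> t _; rewrite lee_fin expR_ge0.
    - apply/measurable_EFinP/measurable_funTS.
      apply: measurableT_comp; first exact: measurable_expR.
      exact: oppr_measurable.
    - exact: measurable_gamma_integrand.
    move=> t /=; rewrite in_itv/= andbT => t1; rewrite lee_fin ler_peMl ?expR_ge0//.
    by rewrite -[leLHS](powRr0 t); apply: ler_powR => //; lra.
  apply: ge0_subset_integral => //; try exact: measurable_gamma_integrand.
  - by move=> t _; rewrite lee_fin gamma_integrand_ge0.
  - by move=> t /=; rewrite !in_itv/= !andbT; exact: lt_le_trans.
move=> x0; have : 0 < Gamma (x + 1) by apply: ge1; lra.
by rewrite GammaD1// pmulr_rgt0.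
Qed.

End gamma.

(** * Wendel's inequality and Gamma(y + a) ~ y^a Gamma(y) *)

Section gamma_asymptotics.
Context {R : realType}.
Implicit Types (x y a s t : R).

(** The concave function t^s lies below its tangent at [y]. It is deduced from Young's inequality
    with exponents 1/s and 1/(1-s), which sets the endpoints [s = 0] and [s = 1] apart. *)
Lemma powR_amgm s t y : 0 <= s <= 1 -> 0 <= t -> 0 < y ->
  t `^ s <= y `^ s * (1 - s + s * (t / y)).
Proof.
move=> /andP[s0 s1] t0 y0.
have -> : t = y * (t / y) by rewrite mulrC divfK// gt_eqF.
set u := t / y; have u0 : 0 <= u by rewrite divr_ge0// ltW.
rewrite (mulrC y u) mulfK ?gt_eqF// mulrC powRM ?(ltW y0)// ler_wpM2l ?powR_ge0//.
have [->|sn0] := eqVneq s 0; first by rewrite powRr0 mul0r addr0 subr0.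
have [->|sn1] := eqVneq s 1; first by rewrite powRr1// mul1r subrr add0r.
have sp : 0 < s by rewrite lt_def sn0.
have s1p : 0 < 1 - s by rewrite subr_gt0 lt_def eq_sym sn1.
have := @conjugate_powR R (u `^ s) 1 s^-1 (1 - s)^-1 (powR_ge0 _ _) ler01.
rewrite !invr_gt0 !invrK => /(_ sp s1p); rewrite addrCA subrr addr0 => /(_ erefl).
rewrite mulr1 -powRrM mulfV ?gt_eqF// powRr1// powR1 mul1r => /le_trans; apply.
by rewrite addrC (mulrC u).
Qed.

(* Integrate [powR_amgm] against [t `^ (y - 1) * expR (- t)]. *)
Lemma Gamma_wendel y s : 0 < y -> 0 <= s <= 1 -> Gamma (y + s) <= y `^ s * Gamma y.
Proof.
move=> y0 s01; have [s0 s1] := andP s01.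
have ys0 : 0 < y + s by rewrite ltr_wpDr.
have y10 : 0 < y + 1 by rewrite ltr_wpDr.
pose A := y `^ s * (1 - s); pose B := y `^ s * (s / y).
have A0 : 0 <= A by rewrite mulr_ge0 ?powR_ge0 ?subr_ge0.
have B0 : 0 <= B by rewrite mulr_ge0 ?powR_ge0 ?divr_ge0// ltW.
have -> : y `^ s * Gamma y = A * Gamma y + B * Gamma (y + 1).
  by rewrite (GammaD1 y0) /A /B; field; rewrite gt_eqF.
rewrite -lee_fin (EFinD (A * _)) (EFinM A) (EFinM B) (GammaE ys0) (GammaE y0) (GammaE y10) /gamma_integral.
rewrite -!ge0_integralZl_EFin//; try exact: measurable_gamma_integrand;
  try by move=> t _; rewrite lee_fin gamma_integrand_ge0.
have mg (c z : R) : measurable_fun (`]0%R, +oo[%classic : set R) (fun t : R => c%:E * (gamma_integrand z t)%:E)%E.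
  by apply: measurable_funeM; exact: measurable_gamma_integrand.
have ge0 (c : R) z (t : R) : 0 <= c -> (0 <= c%:E * (gamma_integrand z t)%:E)%E.
  by move=> c0; rewrite -EFinM lee_fin mulr_ge0// gamma_integrand_ge0.
rewrite -ge0_integralD//; try (by move=> t _; exact: ge0); try exact: mg.
apply: ge0_le_integral => //.
- by move=> t _; rewrite lee_fin gamma_integrand_ge0.
- exact: measurable_gamma_integrand.
- by apply: emeasurable_funD; exact: mg.
move=> t /=; rewrite in_itv/= andbT => t0.
rewrite -!EFinM -EFinD lee_fin /gamma_integrand !mulrA -mulrDl ler_wpM2r ?expR_ge0//.
have tn0 : (t != 0) by rewrite gt_eqF.
have -> : y + s - 1 = (y - 1) + s by ring.
rewrite powRD ?tn0 ?implybT// addrK.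
have -> : t `^ y = t `^ (y - 1) * t by rewrite mulrC mulr_powRB1// ltW.
have -> : A * t `^ (y - 1) + B * (t `^ (y - 1) * t) =
    t `^ (y - 1) * (y `^ s * (1 - s + s * (t / y))).
  by rewrite /A /B; field; rewrite gt_eqF.
by rewrite ler_wpM2l ?powR_ge0// powR_amgm// ltW.
Qed.

Definition Gamma_ratio a y : R := Gamma (y + a) / (Gamma y * y `^ a).

(** Wendel's inequality at [y] bounds the ratio by 1. At [y + s] with exponent [1 - s] it bounds
    Gamma(y + 1), giving the lower bound y / (y + s), which is at least 1 - 1/y. *)
Let Gamma_ratio01 s : 0 <= s <= 1 -> Gamma_ratio s y @[y --> +oo] --> (1 : R).
Proof.
move=> s01; have [s0 s1] := andP s01.
have iy : (y^-1 : R) @[y --> +oo] --> (0 : R).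
  apply/(@gtr0_cvgV0 R _ _ _ id); last exact: cvg_id.
  by near=> y; near: y; exact: nbhs_pinfty_gt.
apply: (@squeeze_cvgr _ _ _ _ (fun y => 1 - y^-1) (fun=> 1)); last 2 first.
- by rewrite -[X in _ --> X]subr0; apply: cvgB => //; exact: cvg_cst.
- exact: cvg_cst.
near=> y; have y0 : 0 < y by near: y; exact: nbhs_pinfty_gt.
have ys0 : 0 < y + s by rewrite ltr_wpDr.
have G0 := Gamma_gt0 y0; have P0 : 0 < y `^ s by rewrite powR_gt0.
have GP0 : 0 < Gamma y * y `^ s by rewrite mulr_gt0.
rewrite /Gamma_ratio ler_pdivlMr// ler_pdivrMr// mul1r; apply/andP; split; last first.
  by rewrite mulrC Gamma_wendel.
have s'01 : 0 <= 1 - s <= 1 by apply/andP; split; lra.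
have := Gamma_wendel ys0 s'01.
have -> : y + s + (1 - s) = y + 1 by ring.
rewrite (GammaD1 y0) => h.
have h2 : y * Gamma y * y `^ s <= (y + s) * Gamma (y + s).
  have : y `^ s <= (y + s) `^ s by rewrite ge0_ler_powR// ?nnegrE ?(ltW y0) ?(ltW ys0)// lerDl.
  move=> /(ler_wpM2l (ltW (mulr_gt0 y0 G0))) /le_trans; apply.
  have := ler_wpM2r (powR_ge0 (y + s) s) h; move=> /le_trans; apply.
  rewrite mulrAC -powRD ?subrK ?powRr1 ?(ltW ys0)//.
  by rewrite (gt_eqF ys0) implybT.
have h3 : (1 - y^-1) * (y + s) <= y.
  have -> : (1 - y^-1) * (y + s) = y - (1 - s) - s * y^-1 by field; rewrite gt_eqF.
  have sy : 0 <= s * y^-1 by rewrite mulr_ge0// invr_ge0 ltW.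
  by rewrite lerBlDr ler_wpDr// lerBlDr ler_wpDr// subr_ge0.
rewrite -(ler_pM2l ys0) (le_trans _ h2)// mulrA [(y + s) * _]mulrC.
by rewrite -[leRHS]mulrA ler_wpM2r// ltW.
Unshelve. all: by end_near. Qed.

(** Lowering [a] by 1 costs the factor (y + a - 1) / y, which tends to 1; this reduces to a shift in
    [0, 1]. *)
Lemma Gamma_ratio_cvg a : 0 <= a -> Gamma_ratio a y @[y --> +oo] --> (1 : R).
Proof.
have iy : (y^-1 : R) @[y --> +oo] --> (0 : R).
  apply/(@gtr0_cvgV0 R _ _ _ id); last exact: cvg_id.
  by near=> y; near: y; exact: nbhs_pinfty_gt.
have [n] := ubnP (Num.truncn a); elim: n a => // n ih a an a0.
have [a1|a1] := leP a 1; first by apply: Gamma_ratio01; rewrite a0.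
have a10 : 0 <= a - 1 by lra.
have : Gamma_ratio (a - 1) y * (1 + (a - 1) * y^-1) @[y --> +oo] --> (1 * (1 + (a - 1) * 0) : R).
  apply: cvgM.
    apply: ih => //; rewrite -ltnS (leq_trans _ an)// ltnS.
    have : (Num.truncn (a - 1))%:R <= a - 1 by rewrite truncn_le.
    rewrite -(ltr_nat R) => /le_lt_trans; apply.
    have : a < (Num.truncn a).+1%:R by exact: truncnS_gt.
    rewrite -natr1; lra.
  by apply: cvgD; [exact: cvg_cst|apply: cvgMr].
rewrite mulr0 addr0 mulr1; apply: cvg_trans; apply: near_eq_cvg.
near=> y; have y0 : 0 < y by near: y; exact: nbhs_pinfty_gt.
have ya : 0 < y + (a - 1) by rewrite ltr_wpDr.
have -> : 1 + (a - 1) * y^-1 = (y + (a - 1)) / y by field; rewrite gt_eqF.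
have -> : Gamma_ratio a y = (y + (a - 1)) * Gamma (y + (a - 1)) / (Gamma y * (y * y `^ (a - 1))).
  rewrite /Gamma_ratio mulr_powRB1 ?(ltW y0)//; last by lra.
  have ya1 : y + (a - 1) + 1 = y + a by ring.
  by rewrite -(GammaD1 ya) ya1.
have Gy := Gamma_gt0 y0; have P0 : 0 < y `^ (a - 1) by rewrite powR_gt0.
rewrite /Gamma_ratio; move: (Gamma (y + (a - 1))) (Gamma y) (y `^ (a - 1)) Gy P0 => g1 g2 p g20 p0.
by field; rewrite !gt_eqF.
Unshelve. all: by end_near. Qed.

End gamma_asymptotics.

(** * Counts of the generalized Waring process *)

(** The case [x = 0] occurs for sets of [mu]-measure 0: the first factor of the product vanishes, in
    accordance with the convention in [rising]. *)
Lemma rising_nat {R : realType} (x : R) n : 0 <= x ->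
  rising x n%:R = \prod_(j < n) (x + j%:R).
Proof.
rewrite le_eqVlt /rising => /predU1P[<-|x0].
  rewrite eqxx; case: n => [|n]; first by rewrite big_ord0 eqxx.
  by rewrite big_ord_recl addr0 mul0r pnatr_eq0.
rewrite gt_eqF//; have G0 := Gamma_gt0 x0.
elim: n => [|n ih]; first by rewrite addr0 divff ?gt_eqF// big_ord0.
rewrite big_ord_recr /= -ih -natr1 addrA GammaD1; last by rewrite ltr_wpDr.
by rewrite mulrC mulrA mulrAC [_^-1 * _]mulrC.
Qed.

(** The four gamma values are regrouped by base point, c k with shift [a] and (c + M) k with shift a
    + X, where M sums the [m i] and X the [x i]. The powers of [k] then cancel against the k^X
    coming from the rising factorials, and [k] survives only in ratios tending to 1 and in terms j /
    k. *)
Lemma mgwd_pmf_gamma_ratio {R : realType} (a c k : R) l (m : 'I_l -> R) (x : 'I_l -> nat) :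
  0 < a -> 0 < c -> 0 < k -> (forall i, 0 <= m i) ->
  mgwd_pmf a (c * k) (fun i => k * m i) x =
  Gamma_ratio a (c * k) /
  Gamma_ratio (a + (\sum_(i < l) x i)%N%:R) ((c + \sum_(i < l) m i) * k) *
  (c `^ a * \prod_(i < l) ((\prod_(j < x i) (m i + j%:R * k^-1)) / (x i)`!%:R) *
   \prod_(j < (\sum_(i < l) x i)%N) (a + j%:R) *
   (c + \sum_(i < l) m i) `^ (- (a + (\sum_(i < l) x i)%N%:R))).
Proof.
move=> a0 c0 k0 m0; rewrite /mgwd_pmf.
set X := (\sum_(i < l) x i)%N; set M := \sum_(i < l) m i.
have M0 : 0 <= M by apply: sumr_ge0.
have ck0 : 0 < c * k by rewrite mulr_gt0.
have cM0 : 0 < c + M by rewrite ltr_wpDr.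
have cMk0 : 0 < (c + M) * k by rewrite mulr_gt0.
rewrite -mulr_sumr -/M (rising_nat _ (ltW a0)).
have -> : \prod_(i < l) (rising (k * m i) (x i)%:R / ((x i)`!)%:R) =
    k ^+ X * \prod_(i < l) ((\prod_(j < x i) (m i + j%:R * k^-1)) / (x i)`!%:R).
  rewrite /X expr_sum -big_split /=; apply: eq_bigr => i _.
  rewrite rising_nat ?mulr_ge0 ?(ltW k0)// mulrA; congr (_ / _).
  rewrite -[in k ^+ _](card_ord (x i)) -prodr_const -big_split /=.
  by apply: eq_bigr => j _; field; rewrite gt_eqF.
rewrite /rising !gt_eqF ?addr_gt0// /Gamma_ratio.
have -> : c * k + a + (k * M + X%:R) = (c + M) * k + (a + X%:R) by ring.
have -> : c * k + k * M = (c + M) * k by ring.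
have kX : k `^ (a + X%:R) = k `^ a * k ^+ X.
  by rewrite powRD ?(gt_eqF k0) ?implybT// powR_mulrn// ltW.
rewrite !powRM ?(ltW c0) ?(ltW k0) ?(ltW cM0)// kX powRN.
have G1 := Gamma_gt0 ck0; have G2 := Gamma_gt0 cMk0.
have G3 : 0 < Gamma ((c + M) * k + (a + X%:R)) by apply: Gamma_gt0; rewrite addr_gt0// ltr_wpDr.
have G4 : 0 < Gamma (c * k + a) by apply: Gamma_gt0; rewrite addr_gt0.
have P1 : 0 < k `^ a by rewrite powR_gt0.
have P2 : 0 < c `^ a by rewrite powR_gt0.
have P3 : 0 < (c + M) `^ (a + X%:R) by rewrite powR_gt0.
have P4 : 0 < k ^+ X by rewrite exprn_gt0.
move: (\prod_(i < l) _) (\prod_(j < X) _) => Q1 Q2.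
move: (Gamma (c * k)) (Gamma ((c + M) * k)) (Gamma ((c + M) * k + (a + X%:R))) (Gamma (c * k + a)) G1 G2 G3 G4.
move: (k `^ a) (c `^ a) ((c + M) `^ (a + X%:R)) (k ^+ X) P1 P2 P3 P4.
move=> p1 p2 p3 p4 P1 P2 P3 P4 g1 g2 g3 g4 G1 G2 G3 G4.
by field; rewrite !gt_eqF.
Qed.

Lemma mgwd_cvg_neg_binomial {R : realType} (a c : R) l (m : 'I_l -> R) (x : 'I_l -> nat) :
  0 < a -> 0 < c -> (forall i, 0 <= m i) ->
  mgwd_pmf a (c * k%:R) (fun i => k%:R * m i) x @[k --> \oo] --> neg_binomial_pmf a c m x.
Proof.
move=> a0 c0 m0; set X := (\sum_(i < l) x i)%N; set M := \sum_(i < l) m i.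
have M0 : 0 <= M by apply: sumr_ge0.
have cM0 : 0 < c + M by rewrite ltr_wpDr.
have toinf (b : R) : 0 < b -> b * k%:R @[k --> \oo] --> +oo.
    move=> b0; apply: (@cvg_comp _ _ _ (fun k : nat => k%:R : R) (fun y => b * y) _ _ _ cvgr_idn).
  exact: gt0_cvgMry b0 cvg_id.
have rat (b e : R) : 0 < b -> 0 <= e -> Gamma_ratio e (b * k%:R) @[k --> \oo] --> (1 : R).
  by move=> b0 e0; exact: cvg_comp (toinf _ b0) (Gamma_ratio_cvg e0).
have lim : Gamma_ratio a (c * k%:R) / Gamma_ratio (a + X%:R) ((c + M) * k%:R) *
    (c `^ a * \prod_(i < l) ((\prod_(j < x i) (m i + j%:R * k%:R^-1)) / (x i)`!%:R) *
     \prod_(j < X) (a + j%:R) * (c + M) `^ (- (a + X%:R)))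
    @[k --> \oo] --> 1 / 1 * neg_binomial_pmf a c m x.
  apply: cvgM.
    apply: cvgM; first exact: (rat _ _ c0 (ltW a0)).
    apply: cvgV; first exact: oner_neq0.
    by apply: (rat _ _ cM0); rewrite addr_ge0// ltW.
  apply: cvgM; last exact: cvg_cst.
  apply: cvgM; last exact: cvg_cst.
  apply: cvgM; first exact: cvg_cst.
  apply: cvg_big => [|i _]; first exact: mul_continuous.
  apply: cvgM; last exact: cvg_cst.
  rewrite -[m i ^+ x i](_ : \prod_(j < x i) (m i + j%:R * 0) = _); last first.
    under eq_bigr do rewrite mulr0 addr0.
    by rewrite prodr_const card_ord.
  apply: cvg_big => [|j _]; first exact: mul_continuous.
  apply: cvgD; first exact: cvg_cst.
  apply: cvgMr; apply/gtr0_cvgV0; last exact: cvgr_idn.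
  by near=> k; rewrite ltr0n; near: k; exists 1%N.
rewrite divr1 mul1r in lim; apply: cvg_trans lim; apply: near_eq_cvg.
near=> k; apply/esym/mgwd_pmf_gamma_ratio => //.
by rewrite ltr0n; near: k; exists 1%N.
Unshelve. all: by end_near. Qed.

Lemma waring_fidi_cvg {R : realType} {S : completePseudoMetricType R}
    (mu : {measure set (borelT S) -> \bar R}) (a c : R)
    (dO : nat -> measure_display) (O : forall k, measurableType (dO k))
    (P : forall k, probability (O k) R)
    (N : forall k, O k -> {measure set (borelT S) -> \bar R})
    l (A : 'I_l -> set S) (x : 'I_l -> nat) :
  0 < a -> 0 < c ->
  (forall k : nat, (0 < k)%N ->
     gen_waring_process (P k) (@N k) a (c * k%:R) k%:R mu) ->
  disj_bounded_family A ->
  (P k (cylinder (@N k) A x) @[k --> \oo] -->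
    (neg_binomial_pmf a c (fun i => fine (mu (A i))) x)%:E)%E.
Proof.
move=> a0 c0 HN dA.
have m0 i : 0 <= fine (mu (A i)) by rewrite fine_ge0.
have : (mgwd_pmf a (c * k%:R) (fun i => k%:R * fine (mu (A i))) x)%:E @[k --> \oo] -->
    (neg_binomial_pmf a c (fun i => fine (mu (A i))) x)%:E.
  by apply: cvg_EFin; [exact: nearW|exact: mgwd_cvg_neg_binomial].
apply: cvg_trans; apply: near_eq_cvg; exists 1%N => // k /= k0.
by have [_ h] := HN k k0; rewrite /cylinder h.
Qed.

Lemma neg_binomial_pmf_void {R : realType} (a c m : R) : 0 < c -> 0 <= m ->
  neg_binomial_pmf a c (fun _ : 'I_1 => m) (fun=> 0%N) = (c / (c + m)) `^ a.
Proof.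
move=> c0 m0; have cm0 : 0 < c + m by rewrite ltr_wpDr.
rewrite /neg_binomial_pmf !big_ord1 big_ord0 fact0 expr0 divr1 !mulr1 addr0.
rewrite powRM ?invr_ge0 ?(ltW c0) ?(ltW cm0)//; congr (_ * _).
by rewrite -(powR_inv1 (ltW cm0)) -powRrM mulN1r.
Qed.

Theorem theorem13 (R : realType) (S : completePseudoMetricType R)
  (S_metric : hausdorff_space S)
  (S_separable : exists D : set S, countable D /\ dense D)
  (mu : {measure set (borelT S) -> \bar R})
  (mu_bfinite : bfinite mu) (mu_nonatomic : nonatomic mu)
  (a c : R) (a_gt0 : 0 < a) (c_gt0 : 0 < c)
  (dO : nat -> measure_display) (O : forall k, measurableType (dO k))
  (P : forall k, probability (O k) R)
  (N : forall k, O k -> {measure set (borelT S) -> \bar R})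
  (HN : forall k : nat, (0 < k)%N ->
          gen_waring_process (P k) (N k) a (c * k%:R) k%:R mu)
  (d0 : measure_display) (O0 : measurableType d0) (P0 : probability O0 R)
  (N0 : O0 -> {measure set (borelT S) -> \bar R})
  (HN0 : neg_binomial_process P0 N0 a c mu) :
  pp_weak_cvg P N P0 N0 /\
  (forall A : set S, bounded_borel A ->
     ((fun k => P k [set w | N k w A = 0%E]) @ \oo -->
        ((c / (c + fine (mu A))) `^ a)%:E)%E /\
     P0 [set w | N0 w A = 0%E] = ((c / (c + fine (mu A))) `^ a)%:E).
Proof.
have wf l (A : 'I_l -> set S) x (dA : disj_bounded_family A) :=
  waring_fidi_cvg (x:=x) a_gt0 c_gt0 HN dA.
split.
  apply: weak_cvg_of_fidi => //.
  - by move=> k /HN[].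
  - by case: HN0.
  - by move=> l A dA x; rewrite (neg_binomial_fidi x a_gt0 c_gt0 HN0 dA); exact: wf.
move=> A bA.
have dA : disj_bounded_family (fun _ : 'I_1 => A).
  by split=> // i j; rewrite !ord1 eqxx.
have m0 : 0 <= fine (mu A) by rewrite fine_ge0.
have voidE (T : Type) (N' : T -> {measure set (borelT S) -> \bar R}) :
    [set w | N' w A = 0%E] = cylinder N' (fun _ : 'I_1 => A) (fun=> 0%N).
  by apply/seteqP; split => w h; [move=> i; exact: h|exact: (h ord0)].
rewrite -(neg_binomial_pmf_void a c_gt0 m0); split.
  by under eq_fun do rewrite voidE; exact: wf.
by rewrite voidE (neg_binomial_fidi _ a_gt0 c_gt0 HN0 dA).
Qed.
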